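(* Let $\Sigma$ be a finite set of linear dependencies and $Q$ a safe BUCQ, both fixed. Deciding, given a database $\mathcal{D}$, whether $\langle\Sigma,\mathcal{D}\rangle$ IAR-entails $Q$ is in PTIME with respect to data complexity.
   Context: A signature is a set of predicate symbols with arities, always containing a special 0-ary predicate $\bot$. A term is a constant or a variable; a (predicate) atom is $p(t_1,\dots,t_n)$; an inequality is $t\neq t'$. A database is a finite set of ground atoms (facts) not containing $\bot$. A conjunction with inequalities is a conjunction of at least one predicate atom or inequality. A CQ is $\exists\vec y\,\gamma$ with $\gamma$ a conjunction with inequalities; it is safe if every variable occurs in a predicate atom; a UCQ is a finite disjunction of CQs; a safe BUCQ is a UCQ without free variables all of whose CQs are safe. A dependency is a first-order sentence $\forall\vec x\,(\gamma\rightarrow Q')$ where $\gamma$ (the body) is a conjunction with inequalities whose variables are in $\vec x$, each occurring in some predicate atom of $\gamma$, and $Q'$ (the head) is a UCQ whose free variables are among $\vec x$ and in which every existentially quantified variable of each disjunct occurs in a predicate atom of that disjunct. A dependency is linear if its body contains exactly one predicate atom. $\mathcal{D}$ is consistent with $\Sigma$ if $\mathcal{D}$ satisfies every dependency of $\Sigma$. A repair of $\langle\Sigma,\mathcal{D}\rangle$ is an inclusion-maximal subset of $\mathcal{D}$ consistent with $\Sigma$. $\langle\Sigma,\mathcal{D}\rangle$ IAR-entails $Q$ if the intersection of all repairs satisfies $Q$. *)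

(* Defs.v *)
From mathcomp Require Import all_boot.
Set Implicit Arguments. Unset Strict Implicit. Unset Printing Implicit Defensive.

Inductive term := Cst of nat | Var of nat.
(* Predicate symbols: the special 0-ary [Bot] and ordinary symbols [P p];
   the signature assigns arity [ar p] to [P p]. *)
Inductive psym := Bot | P of nat.
Inductive lit := LAtom of psym & seq term | LNeq of term & term.

Definition Forall_seq (T : Type) (A : T -> Prop) (s : seq T) : Prop :=
  foldr (fun x acc => A x /\ acc) True s.
Definition Exists_seq (T : Type) (A : T -> Prop) (s : seq T) : Prop :=
  foldr (fun x acc => A x \/ acc) False s.

(* CQ  exists cq_ex, cq_body *)
Record CQ := mkCQ { cq_ex : seq nat; cq_body : seq lit }.
(* UCQ = finite disjunction of CQs *)
Definition UCQ := seq CQ.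
(* dependency  forall dep_univ, dep_body -> dep_head *)
Record dep := mkDep { dep_univ : seq nat; dep_body : seq lit; dep_head : UCQ }.

Definition term_vars (t : term) : seq nat := if t is Var v then [:: v] else [::].
Definition lit_vars (l : lit) : seq nat :=
  match l with
  | LAtom _ ts => flatten (map term_vars ts)
  | LNeq t t' => term_vars t ++ term_vars t'
  end.
Definition conj_vars (c : seq lit) : seq nat := flatten (map lit_vars c).
Definition atom_vars (c : seq lit) : seq nat :=
  flatten (map (fun l => if l is LAtom _ ts then flatten (map term_vars ts) else [::]) c).
Definition is_atom (l : lit) : bool := if l is LAtom _ _ then true else false.

Definition lit_wf (ar : nat -> nat) (l : lit) : Prop :=
  match l with
  | LAtom Bot ts => ts = [::]
  | LAtom (P p) ts => size ts = ar p
  | LNeq _ _ => True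
  end.
Definition conj_wf ar (c : seq lit) : Prop := c <> [::] /\ Forall_seq (lit_wf ar) c.

Definition cq_free_vars (q : CQ) : seq nat :=
  [seq v <- conj_vars (cq_body q) | v \notin cq_ex q].
Definition cq_wf ar (q : CQ) : Prop := conj_wf ar (cq_body q).
Definition cq_safe (q : CQ) : Prop :=
  forall v, v \in conj_vars (cq_body q) -> v \in atom_vars (cq_body q).

Definition safe_BUCQ ar (Q : UCQ) : Prop :=
  Forall_seq (fun q => cq_wf ar q /\ cq_free_vars q = [::] /\ cq_safe q) Q.

Definition dep_wf ar (d : dep) : Prop :=
  conj_wf ar (dep_body d) /\
  (forall v, v \in conj_vars (dep_body d) ->
     v \in dep_univ d /\ v \in atom_vars (dep_body d)) /\
  Forall_seq (fun q => cq_wf ar q /\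
      (forall v, v \in cq_free_vars q -> v \in dep_univ d) /\
      (forall v, v \in cq_ex q -> v \in atom_vars (cq_body q))) (dep_head d).

Definition linear_dep (d : dep) : Prop := count is_atom (dep_body d) = 1.

(* A ground fact p(c_1,...,c_n) with p an ordinary predicate (no Bot). *)
Definition fact := (nat * seq nat)%type.
Definition interp := fact -> Prop.

Definition eval (nu : nat -> nat) (t : term) : nat :=
  match t with Cst c => c | Var v => nu v end.

Definition holds_lit (I : interp) (nu : nat -> nat) (l : lit) : Prop :=
  match l with
  | LAtom Bot _ => False
  | LAtom (P p) ts => I (p, map (eval nu) ts)
  | LNeq t t' => eval nu t <> eval nu t'
  end.
Definition holds_conj I nu (c : seq lit) : Prop := Forall_seq (holds_lit I nu) c.

Definition sat_CQ (I : interp) (nu : nat -> nat) (q : CQ) : Prop :=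
  exists nu' : nat -> nat,
    (forall v, v \notin cq_ex q -> nu' v = nu v) /\ holds_conj I nu' (cq_body q).
Definition sat_UCQ I nu (Q : UCQ) : Prop := Exists_seq (sat_CQ I nu) Q.

Definition sat_dep (I : interp) (d : dep) : Prop :=
  forall nu, holds_conj I nu (dep_body d) -> sat_UCQ I nu (dep_head d).
Definition consistent (I : interp) (Sigma : seq dep) : Prop :=
  Forall_seq (sat_dep I) Sigma.

(* A database is a finite list of facts; duplicates/order are irrelevant. *)
Definition db_wf ar (D : seq fact) : Prop := Forall_seq (fun f => size f.2 = ar f.1) D.

Definition is_repair (Sigma : seq dep) (D : seq fact) (R : interp) : Prop :=
  (forall f, R f -> f \in D) /\ consistent R Sigma /\
  (forall R' : interp, (forall f, R f -> R' f) -> (forall f, R' f -> f \in D) ->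
     consistent R' Sigma -> forall f, R' f -> R f).

Definition IAR_entails (Sigma : seq dep) (D : seq fact) (Q : UCQ) : Prop :=
  sat_UCQ (fun f => f \in D /\ forall R, is_repair Sigma D R -> R f) (fun _ => 0) Q.

Inductive isym := S0 | S1 | SSep | SEnd.
Inductive dir := MoveL | MoveR | Stay.

Record TM := {
  tm_st : finType;
  tm_sym : finType;
  tm_blank : tm_sym;
  tm_inp : isym -> tm_sym;
  tm_start : tm_st;
  tm_acc : tm_st;
  tm_rej : tm_st;
  tm_delta : tm_st -> tm_sym -> tm_st * tm_sym * dir }.

Record config (M : TM) := Cfg {
  c_st : tm_st M; c_left : seq (tm_sym M); c_cur : tm_sym M; c_right : seq (tm_sym M) }.

Definition step (M : TM) (c : config M) : config M :=
  let: Cfg q l a r := c in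
  if (q == tm_acc M) || (q == tm_rej M) then c else
  let: (q', w, d) := tm_delta q a in
  match d with
  | MoveL => match l with [::] => Cfg q' [::] w r | b :: l' => Cfg q' l' b (w :: r) end
  | MoveR => match r with [::] => Cfg q' (w :: l) (tm_blank M) [::]
                        | b :: r' => Cfg q' (w :: l) b r' end
  | Stay => Cfg q' l w r
  end.

Definition init (M : TM) (w : seq isym) : config M :=
  match map (tm_inp M) w with
  | [::] => Cfg (tm_start M) [::] (tm_blank M) [::]
  | a :: r => Cfg (tm_start M) [::] a r
  end.

Definition decides_within (M : TM) (w : seq isym) (t : nat) (A : Prop) : Prop :=
  let q := c_st (iter t (@step M) (init M w)) in
  (q = tm_acc M \/ q = tm_rej M) /\ (q = tm_acc M <-> A).

Fixpoint bits (fuel n : nat) : seq bool :=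
  match fuel with
  | 0 => [::]
  | fuel'.+1 => if n == 0 then [::] else odd n :: bits fuel' n./2
  end.
Definition enc_nat (n : nat) : seq isym := map (fun b => if b then S1 else S0) (bits n n).
Definition enc_fact (f : fact) : seq isym :=
  enc_nat f.1 ++ flatten (map (fun c => SSep :: enc_nat c) f.2) ++ [:: SEnd].
Definition enc_db (D : seq fact) : seq isym := flatten (map enc_fact D).

(* Main.v *)
(* A linear body is witnessed by a single fact, so the union of consistent subsets of
   the database is consistent and there is exactly one repair; it is reached by deleting,
   one at a time, facts that violate a dependency in what is left.  Whether a fact violates
   a dependency, and whether the query holds in the end, are first-order properties of the
   finite list of remaining facts: a universal variable that does not occur in the body needs to
   range only over words of remaining facts, constants of the dependency and one fresh value.

   Such properties are decided on the encoded input with finitely many pebbles.  The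
   Turing machine repeatedly runs a Mealy automaton over the tape, from the last cell to the
   first; every operation on pebbles (moving one to the next cell of some kind, copying
   one, deleting a fact) is one such pass, and words are compared bit by bit by moving
   two cursors.  Reading from right to left, a fact is an end sign followed by its
   arguments in reverse order and then its predicate symbol. *)

Require Import Defs.
From mathcomp Require Import all_boot zify.
From Stdlib Require Import Classical.
Set Implicit Arguments. Unset Strict Implicit. Unset Printing Implicit Defensive.

(** Cost is counted in sweeps; that a sweep takes linearly many machine steps is accounted for only
    once. Programs are composed like monadic code, and their result types are finite so that a
    continuation chosen by a result still has finitely many states. Quantifiers range over facts,
    not values: an atom costs one pebble, and safety lets each existential variable be read off at a
    fixed word of a chosen fact. The arity function is arbitrary, so facts can be longer than any
    fixed bound, while a fixed formula names only finitely many word positions. Hence a universal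
    variable outside the body looks only at the first [dep_width] words of each fact in reading
    order; a fact that has more words than that matches no atom of the dependency, so values found
    only further on can be merged with the fresh one. Deletion loses no fact of the repair because
    heads are monotone: if a repair fact matches a body, the head holds in the repair, hence in
    every larger set of remaining facts. Conversely, a remainder without violations is consistent,
    hence part of the repair. *)

Record sweeper (A R : finType) := Sweeper {
  sw_st : finType;
  sw_start : sw_st;
  sw_delta : sw_st -> A -> sw_st * A;
  sw_fin : sw_st -> sw_st + R }.

(** * Runs of sweeping automata *)

Section Sweeper.
Variables (A R : finType) (M : sweeper A R).

Fixpoint sweep (k : sw_st M) (X : seq A) : sw_st M * seq A :=
  if X is a :: X' then
    let d := sw_delta k a in
    let r := sweep d.1 X' in (r.1, d.2 :: r.2)
  else (k, [::]).

Inductive runs : sw_st M -> seq A -> nat -> R -> seq A -> Prop :=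
| RunsStop k X r : sw_fin (sweep k X).1 = inr r -> runs k X 1 r (sweep k X).2
| RunsMore k X k' t r Z : sw_fin (sweep k X).1 = inl k' ->
    runs k' (sweep k X).2 t r Z -> runs k X t.+1 r Z.

Definition exec X t r Y := exists2 n, n <= t & runs (sw_start M) X n r Y.

Lemma exec_leq X t t' r Y : t <= t' -> exec X t r Y -> exec X t' r Y.
Proof. by move=> tt' [n nt h]; exists n => //; apply: leq_trans tt'. Qed.

Lemma size_sweep k X : size (sweep k X).2 = size X.
Proof. by elim: X k => //= a X IH k; rewrite IH. Qed.

(** Giving the state before each position replaces an induction over the tape for every primitive
    operation. *)
Lemma sweep_mkseq (F G : nat -> A) (st : nat -> sw_st M) n :
  (forall p, p < n -> sw_delta (st p) (F p) = (st p.+1, G p)) ->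
  sweep (st 0) (mkseq F n) = (st n, mkseq G n).
Proof.
rewrite /mkseq => h.
suff: forall m i, i + m = n ->
  sweep (st i) (map F (iota i m)) = (st n, map G (iota i m)) by apply.
elim=> [|m IH] i /=; first by rewrite addn0 => ->.
rewrite addnS => im; have hi : i < n by lia.
by rewrite h //= (IH i.+1) // addSn.
Qed.

Lemma exec_mkseq (F G : nat -> A) (st : nat -> sw_st M) n r :
  st 0 = sw_start M ->
  (forall p, p < n -> sw_delta (st p) (F p) = (st p.+1, G p)) ->
  sw_fin (st n) = inr r ->
  exec (mkseq F n) 1 r (mkseq G n).
Proof.
move=> h0 /sweep_mkseq hs hf; exists 1 => //; rewrite -h0.
have -> : mkseq G n = (sweep (st 0) (mkseq F n)).2 by rewrite hs.
by apply: RunsStop; rewrite hs.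
Qed.
End Sweeper.

(** * Sequencing and iteration of sweeping automata *)

Section Combinators.
Variable A : finType.

Definition retM (R : finType) (r : R) : sweeper A R :=
  @Sweeper A R unit tt (fun k a => (k, a)) (fun _ => inr r).

Lemma sweep_retM (R : finType) (r : R) k X : sweep (M := retM r) k X = (k, X).
Proof. by elim: X => //= a X ->. Qed.

Lemma exec_retM (R : finType) (r : R) X : exec (retM r) X 1 r X.
Proof.
exists 1 => //; have {2}-> : X = (sweep (M := retM r) tt X).2 by rewrite sweep_retM.
exact: RunsStop.
Qed.

Section Bind.
Variables (R S : finType) (p : sweeper A R) (f : R -> sweeper A S).

(** The tagged sum remembers which result [p] returned and is finite because [R] is. Control passes
    to [f r] between two sweeps, so sequencing costs no sweep of its own. *)
Definition bindM : sweeper A S :=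
  @Sweeper A S (sw_st p + {r : R & sw_st (f r)})%type (inl (sw_start p))
    (fun k a => match k with
      | inl k => let d := sw_delta k a in (inl d.1, d.2)
      | inr rk => let d := sw_delta (tagged rk) a in
                  (inr (Tagged (fun r => sw_st (f r)) d.1), d.2)
      end)
    (fun k => match k with
      | inl k => match sw_fin k with
          | inl k' => inl (inl k')
          | inr r => inl (inr (Tagged (fun r => sw_st (f r)) (sw_start (f r))))
          end
      | inr rk => match sw_fin (tagged rk) with
          | inl k' => inl (inr (Tagged (fun r => sw_st (f r)) k'))
          | inr s => inr s
          end
      end).

Lemma sweep_bindl (k : sw_st p) X :
  sweep (M := bindM) (inl k) X = (inl (sweep k X).1, (sweep k X).2).
Proof. by elim: X k => //= a X IH k; rewrite IH. Qed.

Lemma sweep_bindr r (k : sw_st (f r)) X :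
  sweep (M := bindM) (inr (Tagged (fun r => sw_st (f r)) k)) X =
  (inr (Tagged (fun r => sw_st (f r)) (sweep k X).1), (sweep k X).2).
Proof. by elim: X k => //= a X IH k; rewrite IH. Qed.

Lemma runs_bindr r (k : sw_st (f r)) X t s Y : runs k X t s Y ->
  runs (M := bindM) (inr (Tagged (fun r => sw_st (f r)) k)) X t s Y.
Proof.
elim=> {k X t s Y} [k X s h|k X k' t s Z h _ IH].
  have -> : (sweep k X).2 =
    (sweep (M := bindM) (inr (Tagged (fun r => sw_st (f r)) k)) X).2
    by rewrite sweep_bindr.
  by apply: RunsStop; rewrite sweep_bindr /= h.
apply: RunsMore; first by rewrite sweep_bindr /= h.
by rewrite sweep_bindr.
Qed.

Lemma exec_bindM X t r Y t' s Z :
  exec p X t r Y -> exec (f r) Y t' s Z -> exec bindM X (t + t') s Z.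
Proof.
case=> n nt h [n' nt' h']; exists (n + n'); first exact: leq_add.
change (sw_start bindM) with (inl (sw_start p) : sw_st bindM).
elim: h h' => {X r Y nt} [k X r h h'|k X k' m r Y h _ IH h'].
  apply: RunsMore; first by rewrite sweep_bindl /= h.
  by rewrite sweep_bindl; apply: runs_bindr.
apply: RunsMore; first by rewrite sweep_bindl /= h.
by rewrite sweep_bindl; apply: IH.
Qed.
End Bind.

Section Loop.
Variables (R : finType) (p : sweeper A (option R)).

Definition loopM : sweeper A R :=
  @Sweeper A R (sw_st p) (sw_start p) (@sw_delta _ _ p)
    (fun k => match sw_fin k with
      | inl k' => inl k'
      | inr None => inl (sw_start p)
      | inr (Some r) => inr r
      end).

Lemma sweep_loopM k X : sweep (M := loopM) k X = sweep (M := p) k X.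
Proof. by elim: X k => //= a X IH k; rewrite IH. Qed.

Lemma exec_loop_stop X t r Y : exec p X t (Some r) Y -> exec loopM X t r Y.
Proof.
case=> n nt h; exists n => //; move: h.
change (sw_start loopM) with (sw_start p : sw_st loopM).
move e: (Some r) => o h; elim: h e => {X o Y nt} [k X o h e|k X k' m o Y h _ IH e].
  rewrite -sweep_loopM; apply: RunsStop.
  by rewrite sweep_loopM /= h -e.
by apply: RunsMore; rewrite sweep_loopM /= ?h //; apply: IH.
Qed.

Lemma exec_loop_more X t r Y t' Z :
  exec p X t None Y -> exec loopM Y t' r Z -> exec loopM X (t + t') r Z.
Proof.
case=> n nt h [n' nt' h']; exists (n + n'); first exact: leq_add.
change (runs (sw_start p : sw_st loopM) X (n + n') r Z); move: h.
move e: None => o h; elim: h h' e => {X o Y nt} [k X o h h' e|k X k' m o Y h _ IH h' e].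
  apply: RunsMore (sw_start loopM) _ _ _ _ _; last by rewrite sweep_loopM.
  by rewrite sweep_loopM /= h -e.
by apply: RunsMore; rewrite sweep_loopM /= ?h //; apply: IH.
Qed.
End Loop.
End Combinators.

(** * Simulation by a Turing machine *)

Section ToTM.
Variables (A : finType) (inj : isym -> A) (M : sweeper A bool).

(* [None] is the blank and [Some None] the left-end marker. A state [inl (inl g)]
   shifts the input by one cell, holding the symbol [g] still to be written;
   [inl (inr (inl k))] sweeps leftwards, [inl (inr (inr k))] returns. *)
Let tsym : Type := option (option A).
Let tst : Type := (tsym + (sw_st M + sw_st M) + bool)%type.

(** A left move on the first cell leaves the head where it is, so without a marker the end of a
    leftward sweep could not be noticed; hence the initial shift of the input. *)
Definition sweeper_delta (q : tst) (c : tsym) : tst * tsym * dir :=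
  match q with
  | inl (inl g) =>
      if c is None then (inl (inr (inr (sw_start M))), g, MoveR) else (inl (inl c), g, MoveR)
  | inl (inr (inl k)) =>
      match c with
      | Some (Some a) => let d := sw_delta k a in (inl (inr (inl d.1)), Some (Some d.2), MoveL)
      | _ => match sw_fin k with
             | inl k' => (inl (inr (inr k')), c, MoveR)
             | inr b => (inr b, c, Stay)
             end
      end
  | inl (inr (inr k)) =>
      if c is None then (inl (inr (inl k)), None, MoveL) else (q, c, MoveR)
  | inr b => (inr b, c, Stay)
  end.

Definition sweeper_TM : TM :=
  @Build_TM (tsym + (sw_st M + sw_st M) + bool)%type (option (option A)) None
    (fun s => Some (Some (inj s))) (inl (inl (Some None))) (inr true) (inr false)
    sweeper_delta.

Let cell (a : A) : tm_sym sweeper_TM := Some (Some a).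
Let hash : tm_sym sweeper_TM := Some None.
Let blank : tm_sym sweeper_TM := None.

(** [c_left] begins with the cell next to the head, so a tape listed from its last cell to its first
    appears there without reversal. *)
Let atR k X : config sweeper_TM :=
  @Cfg sweeper_TM (inl (inr (inr k))) (map cell X ++ [:: hash]) blank [::].
Let atL k X r : config sweeper_TM :=
  if X is a :: X' then @Cfg sweeper_TM (inl (inr (inl k))) (map cell X' ++ [:: hash]) (cell a) r
  else @Cfg sweeper_TM (inl (inr (inl k))) [::] hash r.
Let back k l Y : config sweeper_TM :=
  if Y is a :: Y' then
    @Cfg sweeper_TM (inl (inr (inr k))) l (cell a) (map cell Y' ++ [:: blank])
  else @Cfg sweeper_TM (inl (inr (inr k))) l blank [::].

Lemma iter_atL k X r :
  iter (size X) (@step sweeper_TM) (atL k X r) =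
  atL (sweep k X).1 [::] (rev (map cell (sweep k X).2) ++ r).
Proof.
elim: X k r => // a X IH k r.
change (size (a :: X)) with (size X).+1; rewrite iterSr.
have -> : step (atL k (a :: X) r) =
  atL (sw_delta k a).1 X (cell (sw_delta k a).2 :: r) by case: X {IH}.
by rewrite IH /= rev_cons cat_rcons.
Qed.

Lemma iter_back k l Y :
  iter (size Y) (@step sweeper_TM) (back k l Y) =
  back k (rev (map cell Y) ++ l) [::].
Proof.
elim: Y l => // a Y IH l; change (size (a :: Y)) with (size Y).+1; rewrite iterSr.
have -> : step (back k l (a :: Y)) =
  back k (cell a :: l) Y by case: Y {IH}.
by rewrite IH /= rev_cons cat_rcons.
Qed.

Lemma step_atR k X : step (atR k X) = atL k X [:: blank].
Proof. by case: X. Qed.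

Lemma iter_stop k X b : sw_fin (sweep k X).1 = inr b ->
  c_st (iter (2 * size X + 2) (@step sweeper_TM) (atR k X)) = inr b.
Proof.
move=> h.
(* One step off the blank, [size X] steps leftwards, one step that halts at the marker; the
   remaining [size X] steps are idle. *)
have -> : 2 * size X + 2 = ((size X).+1 + size X).+1 by lia.
have halt n (c : config sweeper_TM) : c_st c = inr b ->
  c_st (iter n (@step sweeper_TM) c) = inr b.
  move=> hc; elim: n => //= n; case: (iter n _ c) => q l a r /= ->.
  by case: b {h hc}.
rewrite iterSr step_atR iterD iter_atL iterSr.
by apply: halt; rewrite /= h.
Qed.

Lemma iter_more k X k' : sw_fin (sweep k X).1 = inl k' ->
  iter (2 * size X + 2) (@step sweeper_TM) (atR k X) = atR k' (sweep k X).2.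
Proof.
move=> h.
(* One step off the blank, [size X] steps leftwards, one to turn at the marker, [size X] steps
   back. *)
have -> : 2 * size X + 2 = (size X + 1 + size X).+1 by lia.
rewrite iterSr step_atR iterD.
have -> : iter (size X) (@step sweeper_TM) (atL k X [:: blank]) =
   atL (sweep k X).1 [::] (rev (map cell (sweep k X).2) ++ [:: blank]) by exact: iter_atL.
rewrite iterD /= h -(size_sweep k X).
move: (sweep k X).2 => Y.
have -> : match rev (map cell Y) ++ [:: blank] with
  | [::] => @Cfg sweeper_TM (inl (inr (inr k'))) [:: Some None] None [::]
  | b :: r' => @Cfg sweeper_TM (inl (inr (inr k'))) [:: Some None] b r' end =
  back k' [:: hash] (rev Y).
  by rewrite -map_rev; case: (rev Y).
by rewrite -(size_rev Y) iter_back -map_rev revK.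
Qed.

Lemma iter_shift g w :
  iter (size w).+1 (@step sweeper_TM)
    (match map cell w with
     | [::] => @Cfg sweeper_TM (inl (inl g)) [::] blank [::]
     | a :: r => @Cfg sweeper_TM (inl (inl g)) [::] a r end) =
  @Cfg sweeper_TM (inl (inr (inr (sw_start M)))) (rev (map cell w) ++ [:: g]) blank [::].
Proof.
suff H l : iter (size w).+1 (@step sweeper_TM)
    (match map cell w with
     | [::] => @Cfg sweeper_TM (inl (inl g)) l blank [::]
     | a :: r => @Cfg sweeper_TM (inl (inl g)) l a r end) =
  @Cfg sweeper_TM (inl (inr (inr (sw_start M)))) (rev (map cell w) ++ g :: l) blank [::]
  by exact: H.
elim: w g l => // a w IH g l.
rewrite iterSr rev_cons cat_rcons -IH; congr iter.

Qed.

Lemma iter_runs k X t b Y : runs k X t b Y ->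
  c_st (iter (t * (2 * size X + 2)) (@step sweeper_TM) (atR k X)) = inr b.
Proof.
elim=> {k X t b Y} [k X b h|k X k' t b Z h _ IH].
  by rewrite mul1n; apply: iter_stop.
by rewrite mulSnr iterD (iter_more h) -(size_sweep k X).
Qed.

Lemma sweeper_TM_decides w t b Y n (P : Prop) :
  exec M (rev (map inj w)) t b Y -> (b <-> P) ->
  (size w).+1 + t * (2 * size w + 2) <= n ->
  decides_within sweeper_TM w n P.
Proof.
case=> m mt h bP hn; rewrite /decides_within.
suff -> : c_st (iter n (@step sweeper_TM) (init sweeper_TM w)) = inr b.
  case: b bP {h} => -[bP Pb]; split; [by left | | by right |].
    by split=> // _; apply: bP.
  by split=> // /Pb.
have hm : (size w).+1 + m * (2 * size w + 2) <= n.
  by apply: leq_trans hn; rewrite leq_add2l leq_mul2r mt orbT.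
rewrite -(subnK hm) iterD addnC iterD.
have -> : iter (size w).+1 (@step sweeper_TM) (init sweeper_TM w) =
  atR (sw_start M) (rev (map inj w)).
  rewrite /atR map_rev -map_comp.
  by have := iter_shift hash (map inj w); rewrite size_map -map_comp => <-.
have /iter_runs := h; rewrite size_rev size_map => {}h.
elim: (n - _) => //= i; case: (iter i _ _) => q l a r /= ->.
by case: (b).
Qed.
End ToTM.

(** * First-order properties of the marked tape *)

(* [Some (Some b)] is a bit, [Some None] a separator, [None] an end-of-fact sign. *)
Notation sym := (option (option bool)).

Definition is_bit (s : sym) : bool := if s is Some (Some _) then true else false.
Definition obit (s : option sym) : option bool :=
  if s is Some (Some (Some b)) then Some b else None.

Fixpoint first_word (s : seq sym) : seq bool :=
  if s is Some (Some b) :: s' then b :: first_word s' else [::].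

(** The result is never empty, so [head] and [behead] split it faithfully; an end sign or the end of
    the tape closes the last word. *)
Fixpoint fact_words (s : seq sym) : seq (seq bool) :=
  match s with
  | Some (Some b) :: s' => (b :: head [::] (fact_words s')) :: behead (fact_words s')
  | Some None :: s' => [::] :: fact_words s'
  | _ => [:: [::]]
  end.

(** Position [p] is the cell before the word: an end sign, a separator or, during a comparison, the
    bit just read. A fact is identified by the position of its end sign. *)
Definition word_at (B : seq sym) p := first_word (drop p.+1 B).
Definition words_at (B : seq sym) p := fact_words (drop p.+1 B).

Lemma fact_words_head s : fact_words s = first_word s :: behead (fact_words s).
Proof.
elim: s => [|[[b|]|] s IH] //=; by rewrite {1}IH.
Qed.

Lemma words_at_head B p : words_at B p = word_at B p :: behead (words_at B p).
Proof. exact: fact_words_head. Qed.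

Lemma drop_succ (B : seq sym) p : p.+1 < size B ->
  drop p.+1 B = nth None B p.+1 :: drop p.+2 B.
Proof. by move=> h; rewrite (drop_nth None). Qed.

Lemma words_at_next B p p' : p < p' <= size B ->
  (p' < size B -> ~~ is_bit (nth None B p')) ->
  (forall r, p < r < p' -> is_bit (nth None B r)) ->
  words_at B p = word_at B p ::
    (if (p' < size B) && (nth None B p' == Some None) then words_at B p' else [::]).
Proof.
move=> /andP[].
move e: (p' - p) => d; elim: d p e => [|d IH] p e pp' p'B h1 h2; first lia.
have [e1|ne1] := eqVneq p' p.+1.
  rewrite e1 in h1 *; have [lt|ge] := ltnP p.+1 (size B); last first.
    by rewrite /words_at /word_at drop_oversize.
  rewrite /words_at /word_at (drop_succ lt); move: (h1 lt).
  by case: (nth None B p.+1) => [[b|]|].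
have lt : p.+1 < size B by lia.
have hb : is_bit (nth None B p.+1) by apply: h2; lia.
have := IH p.+1; rewrite /words_at /word_at (drop_succ lt).
case: (nth None B p.+1) hb => [[b|]|] //= _ -> //=; try lia.
by move=> r hr; apply: h2; lia.
Qed.

Inductive form :=
| FBool of bool
| FEq of nat * nat & nat * nat
| FEqc of nat * nat & seq bool
| FLen of nat & nat
| FNot of form
| FAnd of form & form
| FEx of form.

(* A variable denotes an element of [E] (a level in the stack [env] of chosen
   elements); a reference [(i, j)] denotes the [j]-th word of element [i].
   Comparisons with a missing word are false. *)
Section Sat.
Variables (E : seq nat) (w : nat -> seq (seq bool)).

Definition deref (env : seq nat) (r : nat * nat) : option (seq bool) :=
  if r.1 < size env then onth (w (nth 0 env r.1)) r.2 else None.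

Fixpoint sat (env : seq nat) (f : form) : bool :=
  match f with
  | FBool b => b
  | FEq r r' => isSome (deref env r) && (deref env r == deref env r')
  | FEqc r c => deref env r == Some c
  | FLen i n => (i < size env) && (size (w (nth 0 env i)) == n)
  | FNot f => ~~ sat env f
  | FAnd f g => sat env f && sat env g
  | FEx f => has (fun x => sat (rcons env x) f) E
  end.
End Sat.

Fixpoint fdepth (f : form) : nat :=
  match f with
  | FNot f => fdepth f
  | FAnd f g => maxn (fdepth f) (fdepth g)
  | FEx f => (fdepth f).+1
  | _ => 0
  end.

(** Number of sweeps on a tape of [N] cells. Only word comparisons and quantifiers depend on [N], so
    this is a polynomial of degree at most [fdepth f + 1]. *)
Fixpoint fcost (f : form) (N : nat) : nat :=
  match f with
  | FBool b => 1
  | FEq r r' => r.2 + r'.2 + 5 + 3 * N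
  | FEqc r c => r.2 + size c + 5
  | FLen i n => n + 4
  | FNot f => fcost f N + 1
  | FAnd f g => fcost f N + fcost g N + 1
  | FEx f => 2 + N * (fcost f N + 2)
  end.

Definition alive_ends (B : seq sym) (dd : nat -> bool) : seq nat :=
  [seq p <- iota 0 (size B) | (nth None B p == None) && ~~ dd p].

(** * Programs that move marks on the tape *)

Section Tape.
Variable K : nat.

Definition mark : Type := ('I_K.+1 + bool)%type.
Definition peb (i : nat) : mark := inl (inord i).
Definition cursor (b : bool) : mark := inr b.

Lemma peb_neq i n : i < n -> n <= K -> peb i <> peb n.
Proof. by move=> h1 h2 [] /(congr1 val) /=; rewrite !inordK; lia. Qed.

Definition tsym : finType := (sym * bool * {ffun ('I_K.+1 + bool) -> bool})%type.

(** A mark whose position is at least [size B] is absent from the tape. *)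
Definition tape (B : seq sym) (M : mark -> nat) (dd : nat -> bool) : seq tsym :=
  mkseq (fun p => (nth None B p, dd p, [ffun m => M m == p])) (size B).

Definition upd (M : mark -> nat) (u : mark) (p : nat) : mark -> nat :=
  fun m => if m == u then p else M m.

Definition put (u : mark) (b : bool) (a : tsym) : tsym :=
  (a.1, [ffun m => if m == u then b else a.2 m]).

(* Moves mark [u] to the next cell satisfying [pr]; with [c0] the search starts
   from the first cell instead of the cell after [u]. *)
Definition advM (c0 : bool) (u : mark) (pr : sym -> bool -> bool) :
    sweeper tsym (option sym) :=
  @Sweeper tsym (option sym) (bool + sym)%type (inl c0)
    (fun k a => match k with
      | inl false => (inl (a.2 u), put u false a)
      | inl true => if pr a.1.1 a.1.2 then (inr a.1.1, put u true a)
                    else (k, put u false a)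
      | inr _ => (k, put u false a)
      end)
    (fun k => if k is inr s then inr (Some s) else inr None).

Definition copyM (i u : mark) : sweeper tsym unit :=
  @Sweeper tsym unit unit tt (fun k a => (k, put u (a.2 i) a)) (fun _ => inr tt).

Definition killM (u : mark) : sweeper tsym unit :=
  @Sweeper tsym unit unit tt
    (fun k a => (k, ((a.1.1, a.1.2 || a.2 u), a.2))) (fun _ => inr tt).

Lemma exec_advM (c0 : bool) (u : mark) (pr : sym -> bool -> bool) B M dd p' : (c0 || (M u < size B)) ->
  let p1 := if c0 then 0 else (M u).+1 in
  p1 <= p' <= size B ->
  (p' < size B -> pr (nth None B p') (dd p')) ->
  (forall r, p1 <= r < p' -> ~~ pr (nth None B r) (dd r)) ->
  exec (advM c0 u pr) (tape B M dd) 1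
    (if p' < size B then Some (nth None B p') else None) (tape B (upd M u p') dd).
Proof.
move=> h0 p1 /andP[p1p' p'B] hpr hnpr.
(* The state before cell [r]: waiting for [u], then searching from [p1] on, then past the target
   [p']. *)
pose st (r : nat) : sw_st (advM c0 u pr) :=
  if r <= p' then inl (p1 <= r) else inr (nth None B p').
apply: (exec_mkseq (st := st)).
- by rewrite /st /= /p1; case: (c0).
- move=> r rB.
  have putE b : b = (p' == r) ->
     put u b (nth None B r, dd r, [ffun m => M m == r]) =
       (nth None B r, dd r, [ffun m => upd M u p' m == r]).
    by move=> ->; congr (_, _); apply/ffunP => m; rewrite !ffunE /upd; case: ifP.
  rewrite /st; have [rp'|p'r] := leqP r p'.
    have [p1r|rp1] := leqP p1 r; rewrite /=.
      have [er|ner] := eqVneq p' r.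
        have -> : pr (nth None B r) (dd r) by rewrite -er; apply: hpr; lia.
        by rewrite putE ?er ?eqxx // ltnn.
      have /negbTE -> : ~~ pr (nth None B r) (dd r) by apply: hnpr; lia.
      have -> : r < p' by lia.
      by rewrite putE ?(negbTE ner) //; congr (inl _, _); lia.
    rewrite ffunE putE; last by lia.
    have -> : r < p' by lia.
    congr (inl _, _); rewrite /p1 in rp1 *; move: rp1; case: (c0) => //; lia.
  rewrite /= putE; last by lia.
  by have -> : (r < p') = false by lia.
- by rewrite /st; case: leqP.
Qed.

Lemma exec_copyM i u B M dd :
  exec (copyM i u) (tape B M dd) 1 tt (tape B (upd M u (M i)) dd).
Proof.
apply: (@exec_mkseq _ _ (copyM i u) _ _ (fun _ => tt)) => // r rB /=; congr (_, (_, _)).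
by apply/ffunP => m; rewrite !ffunE /upd; case: ifP.
Qed.

Lemma exec_killM u B M dd :
  exec (killM u) (tape B M dd) 1 tt (tape B M (fun p => dd p || (M u == p))).
Proof.
by apply: (@exec_mkseq _ _ (killM u) _ _ (fun _ => tt)) => // r rB /=; rewrite ffunE.
Qed.

(** The value [n] stands for a failed search, matching the position of an absent mark. *)
Lemma next_pos (P : pred nat) p1 n : p1 <= n -> exists p',
  [/\ p1 <= p' <= n, (p' < n -> P p') & forall r, p1 <= r < p' -> ~~ P r].
Proof.
move e: (n - p1) => d; elim: d p1 e => [|d IH] p1 e le.
  by exists p1; split; lia.
have [hP|hP] := boolP (P p1); first by exists p1; split => //; lia.
have [||p' [h1 h2 h3]] := IH p1.+1; try lia.
exists p'; split=> // [|r hr]; first lia.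
by have [->//|ne] := eqVneq r p1; apply: h3; lia.
Qed.

Definition agree_off (u : mark) (M M' : mark -> nat) := forall m, m <> u -> M' m = M m.

Lemma upd_off u M p : agree_off u M (upd M u p).
Proof. by move=> m /eqP h; rewrite /upd (negbTE h). Qed.

Lemma upd_same u M p : upd M u p u = p.
Proof. by rewrite /upd eqxx. Qed.

Definition opener (s : sym) (_ : bool) := ~~ is_bit s.

(** Meeting an end sign or the end of the tape before [j] separators means that the fact has no word
    number [j]. *)
Fixpoint seekM (u : mark) (j : nat) : sweeper tsym bool :=
  if j is j'.+1 then
    bindM (advM false u opener) (fun s => if s == Some (Some None) then seekM u j' else retM _ false)
  else retM _ true.

Lemma exec_opener u B M dd : M u < size B -> exists M',
  agree_off u M M' /\
  exists2 s, exec (advM false u opener) (tape B M dd) 1 s (tape B M' dd) &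
    if s == Some (Some None)
    then M' u < size B /\ words_at B (M u) = word_at B (M u) :: words_at B (M' u)
    else words_at B (M u) = [:: word_at B (M u)].
Proof.
move=> h; have [p' [h1 h2 h3]] := next_pos (fun r => ~~ is_bit (nth None B r)) h.
have E := @exec_advM false u opener B M dd p' h h1 h2 h3.
exists (upd M u p'); split; first exact: upd_off.
eexists; first exact: E.
rewrite upd_same (@words_at_next B (M u) p') //; last by move=> r /h3 /negPn.
by case: (p' < size B) => //=; case: (nth None B p') => [[b|]|].
Qed.

Lemma exec_seekM u j B M dd : M u < size B -> exists M',
  [/\ agree_off u M M',
      exec (seekM u j) (tape B M dd) j.+1 (j < size (words_at B (M u))) (tape B M' dd) &
      j < size (words_at B (M u)) ->
        M' u < size B /\ words_at B (M' u) = drop j (words_at B (M u))].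
Proof.
elim: j M => [|j IH] M h /=.
  exists M; split=> //; last by rewrite drop0.
  by rewrite words_at_head; apply: exec_retM.
have [M1 [a1 [s e1]]] := exec_opener dd h.
case: eqP => [es [b1 ->]|ns ->]; last first.
  exists M1; split=> //.
  rewrite -addn1 addnC; apply: (exec_bindM e1).
  by case: eqP => // _; apply: exec_leq (exec_retM _ _).
have [M2 [a2 e2 c2]] := IH M1 b1.
exists M2; split=> //.
  by move=> m hm; rewrite a2 // a1.
rewrite -addn1 addnC; apply: (exec_bindM e1).
by rewrite es eqxx.
Qed.

Definition any_cell (_ : sym) (_ : bool) := true.

Lemma exec_step u B M dd : M u < size B ->
  exec (advM false u any_cell) (tape B M dd) 1
    (if (M u).+1 < size B then Some (nth None B (M u).+1) else None)
    (tape B (upd M u (M u).+1) dd).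
Proof. by move=> h; apply: exec_advM => //=; lia. Qed.

Lemma word_at_step B p :
  word_at B p = if obit (if p.+1 < size B then Some (nth None B p.+1) else None) is Some b
                then b :: word_at B p.+1 else [::].
Proof.
rewrite /word_at; case: ltnP => h; last by rewrite drop_oversize.
by rewrite (drop_succ h); case: (nth None B p.+1) => [[b|]|].
Qed.

Definition cmpM (u v : mark) : sweeper tsym bool :=
  loopM (bindM (advM false u any_cell) (fun s => bindM (advM false v any_cell) (fun s' =>
    retM _ (match obit s, obit s' with
            | Some b, Some b' => if b == b' then None else Some false
            | None, None => Some true
            | _, _ => Some false
            end)))).

(** A round costs three sweeps, one for each cursor and one for the verdict, and brings [u] one cell
    closer to the end of the tape; hence the bound. *)
Lemma exec_cmpM u v B M dd : u <> v -> M u < size B -> M v < size B -> exists M',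
  [/\ (forall m, m <> u -> m <> v -> M' m = M m) &
      exec (cmpM u v) (tape B M dd) (3 * (size B - M u)) (word_at B (M u) == word_at B (M v))
        (tape B M' dd)].
Proof.
move=> uv; move: {2}(size B - M u) (leqnn (size B - M u)) => d; elim: d M => [|d IH] M e hu hv; first lia.
have E1 := exec_step dd hu.
have hv' : upd M u (M u).+1 v < size B by rewrite upd_off //; apply: nesym.
have E2 := exec_step dd hv'.
rewrite upd_off in E2; last by apply: nesym.
set M1 := upd _ v _ in E2.
have E3 (r : option bool) : exec (retM tsym r) (tape B M1 dd) 1 r (tape B M1 dd) := exec_retM r _.
have off1 m : m <> u -> m <> v -> M1 m = M m.
  by move=> h1 h2; rewrite /M1 !upd_off.
rewrite (word_at_step B (M u)) (word_at_step B (M v)).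
set su := if (M u).+1 < _ then _ else _; set sv := if (M v).+1 < _ then _ else _.
have hB : 3 <= 3 * (size B - M u) by lia.
have stop b : match obit su, obit sv with
            | Some b, Some b' => if b == b' then None else Some false
            | None, None => Some true
            | _, _ => Some false
            end = Some b -> exec (cmpM u v) (tape B M dd) (3 * (size B - M u)) b (tape B M1 dd).
  move=> eb; apply: exec_leq hB _; apply: exec_loop_stop.
  apply: (exec_bindM E1); apply: (exec_bindM (t := 1) E2).
  by rewrite eb; apply: (E3 (Some b)).
case eu : (obit su) stop => [b|]; case ev : (obit sv) => [b'|] stop;
  try by exists M1; split=> //; apply: stop.
case: (eqVneq b b') stop => [bb stop|nb stop]; last first.
  by exists M1; split=> //; rewrite eqseq_cons (negbTE nb); apply: stop.
have hu1 : (M u).+1 < size B by move: eu; rewrite /su; case: ifP.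
have hv1 : (M v).+1 < size B by move: ev; rewrite /sv; case: ifP.
have M1u : M1 u = (M u).+1 by rewrite /M1 upd_off // upd_same.
have M1v : M1 v = (M v).+1 by rewrite /M1 upd_same.
have [|||M2 [off2 E4]] := IH M1; rewrite ?M1u ?M1v //; first lia.
exists M2; split; first by move=> m h1 h2; rewrite off2 // off1.
rewrite bb eqseq_cons eqxx /= -M1u -M1v.
have E5 : exec (bindM (advM false u any_cell) (fun s => bindM (advM false v any_cell) (fun s' =>
    retM _ (match obit s, obit s' with
            | Some b, Some b' => if b == b' then None else Some false
            | None, None => Some true
            | _, _ => Some false
            end)))) (tape B M dd) 3 (None : option bool) (tape B M1 dd).
  apply: (exec_bindM E1); apply: (exec_bindM (t := 1) E2).
  by rewrite -/su -/sv eu ev bb eqxx; apply: (E3 None).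
have -> : 3 * (size B - M u) = 3 + 3 * (size B - M1 u) by lia.
exact: exec_loop_more E5 E4.
Qed.
(** The constant comes from the fixed formula, so its bits are built into the control instead of
    being read with a second cursor. *)
Fixpoint cmpcM (u : mark) (c : seq bool) : sweeper tsym bool :=
  if c is b :: c' then
    bindM (advM false u any_cell) (fun s =>
      if obit s == Some b then cmpcM u c' else retM _ false)
  else bindM (advM false u any_cell) (fun s => retM _ (obit s == None)).

Lemma exec_cmpcM u c B M dd : M u < size B -> exists M',
  agree_off u M M' /\
  exec (cmpcM u c) (tape B M dd) (size c + 2) (word_at B (M u) == c) (tape B M' dd).
Proof.
elim: c M => [|b c IH] M hu /=; have E1 := exec_step dd hu.
  eexists; split; first exact: (@upd_off u M (M u).+1).
  apply: (exec_bindM E1); rewrite word_at_step; case: (obit _) => [b|]; exact: exec_retM.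
have off := @upd_off u M (M u).+1.
rewrite word_at_step; set s := if _ < _ then _ else _ in E1 *.
have [es|ns] := eqVneq (obit s) (Some b); last first.
  eexists; split; first exact: off.
  rewrite addSn -add1n; apply: (exec_bindM E1).
  have -> : (if obit s is Some b0 then b0 :: word_at B (M u).+1 else [::]) == b :: c = false.
    case: (obit s) ns => // b0; rewrite eqseq_cons.
    by case: (eqVneq b0 b) => // ->; rewrite eqxx.
  by rewrite (negbTE ns); apply: exec_leq (exec_retM _ _); lia.
have hu1 : (M u).+1 < size B by move: es; rewrite /s; case: ifP.
have [|M2 [off2 E2]] := IH (upd M u (M u).+1); first by rewrite upd_same.
exists M2; split; first by move=> m hm; rewrite off2 // off.
rewrite addSn -add1n; apply: (exec_bindM E1).
by rewrite es eqxx eqseq_cons eqxx /=; move: E2; rewrite upd_same.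
Qed.

(* Tests may leave the cursors and the pebbles of deeper levels anywhere. *)
Definition agree (n : nat) (M M' : mark -> nat) := forall i, i < n -> M' (peb i) = M (peb i).

Definition test (n : nat) (p : sweeper tsym bool) B M dd t b :=
  exists2 M', agree n M M' & exec p (tape B M dd) t b (tape B M' dd).

Lemma test_leq n p B M dd t t' b : t <= t' -> test n p B M dd t b -> test n p B M dd t' b.
Proof. by move=> h [M' a e]; exists M' => //; apply: exec_leq e. Qed.

Lemma test_bind n p f B M dd t b t' b' :
  test n p B M dd t b ->
  (forall M', agree n M M' -> test n (f b) B M' dd t' b') ->
  test n (bindM p f) B M dd (t + t') b'.
Proof.
case=> M1 a1 e1 /(_ M1 a1) [M2 a2 e2]; exists M2; last exact: exec_bindM e1 e2.
by move=> i hi; rewrite a2 // a1.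
Qed.

Lemma test_ret n b B M dd : test n (retM _ b) B M dd 1 b.
Proof. by exists M => //; apply: exec_retM. Qed.

Lemma agree_cursor n b M M' : agree_off (cursor b) M M' -> agree n M M'.
Proof. by move=> h i _; apply: h. Qed.

Definition gotoM (r : nat * nat) (b : bool) : sweeper tsym bool :=
  bindM (copyM (peb r.1) (cursor b)) (fun _ => seekM (cursor b) r.2).

Lemma exec_gotoM r b B M dd : M (peb r.1) < size B ->
  let ws := words_at B (M (peb r.1)) in exists M',
  [/\ agree_off (cursor b) M M',
      exec (gotoM r b) (tape B M dd) (r.2 + 2) (r.2 < size ws) (tape B M' dd) &
      r.2 < size ws -> M' (cursor b) < size B /\ words_at B (M' (cursor b)) = drop r.2 ws].
Proof.
move=> h ws; have E1 := exec_copyM (peb r.1) (cursor b) B M dd.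
have [|M2 [off2]] := @exec_seekM (cursor b) r.2 B (upd M (cursor b) (M (peb r.1))) dd.
  by rewrite upd_same.
rewrite upd_same => E2 h2; exists M2; split=> //.
  by move=> m hm; rewrite off2 // upd_off.
by rewrite addn2 -add1n; apply: (exec_bindM E1).
Qed.

Lemma word_at_drop B p ws j : words_at B p = drop j ws -> j < size ws ->
  onth ws j = Some (word_at B p).
Proof.
move=> e h; have := words_at_head B p; rewrite e (drop_nth [::] h).
move/(congr1 (head [::])) => /= <-.
by rewrite onthE (nth_map [::]).
Qed.

(** On success pebble [n] stays on the witness, which is how the elimination loop knows which fact
    to delete. *)
Definition findM (n : nat) (p : sweeper tsym bool) : sweeper tsym bool :=
  let live (s : sym) (d : bool) := (s == None) && ~~ d in
  bindM (advM true (peb n) live) (fun s =>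
    if s is Some _ then
      loopM (bindM p (fun b => if b then retM _ (Some true) else
        bindM (advM false (peb n) live) (fun s =>
          retM _ (if s is Some _ then None else Some false))))
    else retM _ false).

(** Pebble [i] holds the element at level [i]; each comparison of words first copies pebbles to the
    cursors. In the [FLen] case, word [m.-1] has to exist and not be followed by a separator; length
    0 never occurs because a fact has at least one word. *)
Fixpoint compileM (n : nat) (f : form) : sweeper tsym bool :=
  match f with
  | FBool b => retM _ b
  | FEq r r' =>
      if (r.1 < n) && (r'.1 < n) then
        bindM (gotoM r false) (fun b => if b then
          bindM (gotoM r' true) (fun b => if b then cmpM (cursor false) (cursor true)
                                          else retM _ false)
          else retM _ false)
      else retM _ false
  | FEqc r c =>
      if r.1 < n then
        bindM (gotoM r false) (fun b => if b then cmpcM (cursor false) c else retM _ false)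
      else retM _ false
  | FLen i m =>
      if (i < n) && (0 < m) then
        bindM (gotoM (i, m.-1) false) (fun b => if b then
          bindM (advM false (cursor false) opener) (fun s => retM _ (s != Some (Some None)))
        else retM _ false)
      else retM _ false
  | FNot f => bindM (compileM n f) (fun b => retM _ (~~ b))
  | FAnd f g => bindM (compileM n f) (fun b => if b then compileM n g else retM _ false)
  | FEx f => findM n (compileM n.+1 f)
  end.

(** * Correctness and cost of compiled formulas *)

Section Compile.
Variables (B : seq sym) (dd : nat -> bool).
Let E := alive_ends B dd.

Lemma mem_alive p : (p \in E) = [&& p < size B, nth None B p == None & ~~ dd p].
Proof. by rewrite mem_filter mem_iota add0n /= andbC. Qed.

Definition matches (n : nat) (env : seq nat) (M : mark -> nat) :=
  forall i, i < n -> M (peb i) = nth 0 env i.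

Lemma matches_agree n env M M' : matches n env M -> agree n M M' -> matches n env M'.
Proof. by move=> h a i hi; rewrite a // h. Qed.

Section Find.
Variables (n : nat) (env : seq nat) (p : sweeper tsym bool) (F : nat -> bool) (t : nat).
Hypothesis nK : n <= K.
Hypothesis pF : forall M x, x \in E -> matches n env M -> M (peb n) = x ->
  test n.+1 p B M dd t (F x).

Lemma exec_find_loop m M : size B - M (peb n) <= m -> M (peb n) \in E -> matches n env M ->
  exists M' b, [/\ agree n M M',
    exec (loopM (bindM p (fun b => if b then retM _ (Some true) else
        bindM (advM false (peb n) (fun s d => (s == None) && ~~ d)) (fun s =>
          retM _ (if s is Some _ then None else Some false)))))
      (tape B M dd) (m * (t + 2)) b (tape B M' dd) &
    if b then (M' (peb n) \in E) && F (M' (peb n))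
    else all (fun x => (M (peb n) <= x) ==> ~~ F x) E].
Proof.
elim: m M => [|m IH] M hm hE hM.
  by move: hE; rewrite mem_alive => /andP[]; lia.
have [M1 a1 e1] := pF hE hM erefl.
have M1n : M1 (peb n) = M (peb n) by apply: a1.
have a1' : agree n M M1 by move=> i hi; apply: a1; apply: ltnW.
case: (boolP (F _)) e1 => hF e1.
  exists M1, true; split=> //; last by rewrite M1n hE hF.
  apply: exec_loop_stop; rewrite mulSn -addnA.
  apply: (exec_bindM e1); apply: exec_leq (exec_retM _ _); lia.
have lt : M1 (peb n) < size B by move: hE; rewrite mem_alive M1n => /andP[].
have [p' [h1 h2 h3]] := next_pos (fun r => (nth None B r == None) && ~~ dd r) lt.
have e2 := @exec_advM false (peb n) (fun s d => (s == None) && ~~ d) B M1 dd p' lt h1 h2 h3.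
set M2 := upd _ _ _ in e2.
have M2n : M2 (peb n) = p' by rewrite /M2 upd_same.
have a2 : agree n M M2.
  by move=> i hi; rewrite /M2 upd_off ?a1' //; apply: peb_neq.
(* No live end sign lies strictly between the pebble and [p'], and the one under the pebble fails
   the test. *)
have nF x : x \in E -> M (peb n) <= x -> F x -> p' <= x.
  move=> xE; rewrite leq_eqVlt => /orP[/eqP ex|lt' Fx].
    by rewrite -ex (negbTE hF).
  rewrite leqNgt; apply/negP => xp'; have := h3 x.
  by rewrite M1n lt' xp' => /(_ isT); move: xE; rewrite mem_alive => /and3P[_ -> ->].
case: (ltnP p' (size B)) e2 => hp' e2.
  have M2E : M2 (peb n) \in E by rewrite mem_alive M2n hp' h2.
  have [||M3 [b [a3 e3 h4]]] := IH M2 _ M2E.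
  - by rewrite M2n; rewrite M1n in h1; lia.
  - exact: matches_agree a2.
  exists M3, b; split.
  - by move=> i hi; rewrite a3 // a2.
  - rewrite mulSn; apply: exec_loop_more e3.
    apply: (exec_bindM e1); rewrite -[2]/(1 + 1); apply: (exec_bindM e2).
    exact: exec_retM.
  - case: b h4 {e3} => // /allP h4; apply/allP => x xE; apply/implyP => hx.
    apply/negP => Fx; have := h4 x xE; rewrite M2n (nF x xE hx Fx) Fx.
    by [].
exists M2, false; split=> //.
  apply: exec_loop_stop; rewrite mulSn.
  apply: (exec_leq (t := t + 2)); first by lia.
  apply: (exec_bindM e1); rewrite -[2]/(1 + 1); apply: (exec_bindM e2).
  exact: exec_retM.
apply/allP => x xE; apply/implyP => hx; apply/negP => Fx.
by have := nF x xE hx Fx; move: xE; rewrite mem_alive => /andP[]; lia.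
Qed.

Lemma exec_findM M : matches n env M -> exists M',
  [/\ agree n M M',
    exec (findM n p) (tape B M dd) (2 + size B * (t + 2)) (has F E) (tape B M' dd) &
    has F E -> (M' (peb n) \in E) && F (M' (peb n))].
Proof.
move=> hM.
have [p' [h1 h2 h3]] := next_pos (fun r => (nth None B r == None) && ~~ dd r) (leq0n (size B)).
have e2 := @exec_advM true (peb n) (fun s d => (s == None) && ~~ d) B M dd p' isT h1 h2 h3.
set M2 := upd _ _ _ in e2.
have M2n : M2 (peb n) = p' by rewrite /M2 upd_same.
have a2 : agree n M M2.
  by move=> i hi; rewrite /M2 upd_off //; apply: peb_neq.
have ge x : x \in E -> p' <= x.
  move=> xE; rewrite leqNgt; apply/negP => xp'; have := h3 x.
  by rewrite xp' => /(_ isT); move: xE; rewrite mem_alive => /and3P[_ -> ->].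
case: (ltnP p' (size B)) e2 => hp' e2; last first.
  have -> : has F E = false.
    apply/hasPn => x xE; have := ge x xE.
    by move: xE; rewrite mem_alive => /andP[]; lia.
  exists M2; split=> //; rewrite -[2 + _]/(1 + (1 + _)); apply: (exec_bindM e2).
  by apply: exec_leq (exec_retM _ _); lia.
have M2E : M2 (peb n) \in E by rewrite mem_alive M2n hp' h2.
have [||M3 [b [a3 e3 h4]]] := @exec_find_loop (size B) M2 _ M2E.
- lia.
- exact: matches_agree a2.
have eb : has F E = b.
  case: b h4 {e3} => [/andP[h4 h5]|/allP h4]; first by apply/hasP; exists (M3 (peb n)).
  by apply/hasPn => x xE; have := h4 x xE; rewrite M2n (ge x xE).
exists M3; rewrite eb; split.
- by move=> i hi; rewrite a3 // a2.
- rewrite -[2 + _]/(1 + (1 + _)); apply: (exec_bindM e2); apply: exec_leq e3; lia.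
- by case: b h4 {e3 eb}.
Qed.
End Find.

(** The quantifiers of [f] use the pebbles from [n] to [n + fdepth f - 1], and the last available
    pebble is [K]; hence the bound [K.+1]. *)
Lemma test_compileM f n env M : n + fdepth f <= K.+1 -> size env = n ->
  all (mem E) env -> matches n env M ->
  test n (compileM n f) B M dd (fcost f (size B)) (sat E (words_at B) env f).
Proof.
have lt i env' n' M' : size env' = n' -> all (mem E) env' -> matches n' env' M' -> i < n' ->
   M' (peb i) < size B.
  move=> se /allP h hM hi; rewrite hM //.
  have /h /= : nth 0 env' i \in env' by rewrite mem_nth // se.
  by rewrite mem_alive => /andP[].
elim: f n env M => [b|r r'|r c|i m|f IH|f IHf g IHg|f IH] n env M /= hK se hE hM.
- exact: test_ret.
- rewrite /deref se; case: (ltnP r.1 n) => hr /=; last by apply: test_leq (test_ret _ _ _ _ _); lia.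
  case: (ltnP r'.1 n) => hr' /=; last first.
    rewrite [X in test _ _ _ _ _ _ X](_ : _ = false); last by case: (onth _ _).
    by apply: test_leq (test_ret _ _ _ _ _); lia.
  have hl := lt _ _ _ _ se hE hM hr.
  have [M1 [off1 e1 h1]] := exec_gotoM false dd hl.
  have hM1 := matches_agree hM (agree_cursor (n := n) off1).
  rewrite -!hM //.
  have -> : r.2 + r'.2 + 5 + 3 * size B = r.2 + 2 + (r'.2 + 2 + (1 + 3 * size B)) by lia.
  case: (ltnP r.2 (size (words_at B (M (peb r.1))))) e1 h1 => hj e1 h1; last first.
    rewrite onth_default //=.
    exists M1; first exact: agree_cursor off1.
    by apply: (exec_bindM e1); apply: exec_leq (exec_retM _ _); lia.
  have [c1 w1] := h1 isT.
  have hl' := lt _ _ _ _ se hE hM1 hr'.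
  have [M2 [off2 e2 h2]] := exec_gotoM true dd hl'.
  have hM2 := matches_agree hM1 (agree_cursor (n := n) off2).
  have a2 : agree n M M2 by move=> i hi; rewrite hM2 // hM.
  have eM : M1 (peb r'.1) = M (peb r'.1) by rewrite hM1 // hM.
  rewrite eM in e2 h2 hl'.
  have -> := word_at_drop w1 hj.
  case: (ltnP r'.2 (size (words_at B (M (peb r'.1))))) e2 h2 => hj' e2 h2; last first.
    rewrite (onth_default hj') /=.
    exists M2 => //; apply: (exec_bindM e1); apply: (exec_bindM e2).
    by apply: exec_leq (exec_retM _ _); lia.
  have [c2 w2] := h2 isT.
  have -> := word_at_drop w2 hj'.
  have eu : M2 (cursor false) = M1 (cursor false) by apply: off2.
  have [||//|M3 [off3 e3]] := @exec_cmpM (cursor false) (cursor true) B M2 dd; rewrite ?eu //.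
  exists M3; first by move=> i hi; rewrite off3 // a2.
  apply: (exec_bindM e1); apply: (exec_bindM e2).
  by rewrite eu in e3; apply: exec_leq e3; lia.
- rewrite /deref se; case: (ltnP r.1 n) => hr /=; last by apply: test_leq (test_ret _ _ _ _ _); lia.
  have hl := lt _ _ _ _ se hE hM hr.
  have [M1 [off1 e1 h1]] := exec_gotoM false dd hl.
  have hM1 := matches_agree hM (agree_cursor (n := n) off1).
  rewrite -!hM //.
  have -> : r.2 + size c + 5 = r.2 + 2 + (size c + 2 + 1) by lia.
  case: (ltnP r.2 (size (words_at B (M (peb r.1))))) e1 h1 => hj e1 h1; last first.
    rewrite onth_default //=.
    exists M1; first exact: agree_cursor off1.
    by apply: (exec_bindM e1); apply: exec_leq (exec_retM _ _); lia.
  have [c1 w1] := h1 isT.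
  have -> := word_at_drop w1 hj.
  have [M2 [off2 e2]] := exec_cmpcM c dd c1.
  exists M2; first by move=> i hi; rewrite off2 // hM1 // hM.
  by apply: (exec_bindM e1); apply: exec_leq e2; lia.
- rewrite se; case: (ltnP i n) => hr /=; last by apply: test_leq (test_ret _ _ _ _ _); lia.
  case: m => [|m] /=.
    by rewrite words_at_head /=; apply: test_leq (test_ret _ _ _ _ _); lia.
  have hl := lt _ _ _ _ se hE hM hr.
  have [M1 [off1 e1 h1]] := @exec_gotoM (i, m) false _ _ dd hl.
  have hM1 := matches_agree hM (agree_cursor (n := n) off1).
  rewrite -!hM //; rewrite /= in e1 h1.
  have -> : m.+1 + 4 = m + 2 + (1 + 2) by lia.
  case: (ltnP m (size (words_at B (M (peb i))))) e1 h1 => hj e1 h1; last first.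
    have -> : (size (words_at B (M (peb i))) == m.+1) = false by lia.
    exists M1; first exact: agree_cursor off1.
    by apply: (exec_bindM e1); apply: exec_leq (exec_retM _ _); lia.
  have [c1 w1] := h1 isT.
  have [M2 [off2 [s e2 h2]]] := exec_opener dd c1.
  exists M2; first by move=> k hk; rewrite off2 // hM1 // hM.
  apply: (exec_bindM e1); apply: (exec_bindM e2).
  have -> : (size (words_at B (M (peb i))) == m.+1) = (s != Some (Some None)).
    have := size_drop m (words_at B (M (peb i))); rewrite -w1.
    case: eqP h2 => [_ [_ ->]|_ ->] /=; last by lia.
    by rewrite [words_at B (M2 _)]words_at_head /=; lia.
  by apply: exec_leq (exec_retM _ _); lia.
- apply: test_bind; first exact: IH hM.
  by move=> M' _; apply: test_ret.
- rewrite -addnA; apply: test_bind; first by apply: IHf hM => //; lia.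
  move=> M' a; case: (sat _ _ _ f) => /=; last by apply: test_leq (test_ret _ _ _ _ _); lia.
  apply: (test_leq (t := fcost g (size B))); first by lia.
  by apply: IHg => //; [lia | apply: matches_agree a].
- have [||M' [a e _]] := @exec_findM n env (compileM n.+1 f)
    (fun x => sat E (words_at B) (rcons env x) f) (fcost f (size B)) _ _ M hM.
  + by lia.
  + move=> M1 x xE h1 h2; apply: IH.
    * by lia.
    * by rewrite size_rcons se.
    * by rewrite all_rcons /= xE.
    * move=> i; rewrite ltnS leq_eqVlt nth_rcons se => /orP[/eqP ->|hi].
        by rewrite ltnn eqxx.
      by rewrite hi h1.
  by exists M'.
Qed.
End Compile.
End Tape.

(** * Formulas for queries and violations *)

Section SeqPredicates.
Variable T : Type.

Lemma Forall_seq_impl (A A' : T -> Prop) s :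
  (forall x, A x -> A' x) -> Forall_seq A s -> Forall_seq A' s.
Proof. by move=> h; elim: s => //= x s IH [a b]; split; auto. Qed.

Lemma Forall_seq_and (A A' : T -> Prop) s :
  Forall_seq A s -> Forall_seq A' s -> Forall_seq (fun x => A x /\ A' x) s.
Proof. by elim: s => //= x s IH [a b] [c d]; split; auto. Qed.

Lemma Exists_seq_impl (A A' : T -> Prop) s :
  Forall_seq (fun x => A x -> A' x) s -> Exists_seq A s -> Exists_seq A' s.
Proof. by elim: s => //= x s IH [a b] [c|d]; [left | right]; auto. Qed.

Lemma Forall_seq_flatten (F : T -> seq nat) s :
  Forall_seq (fun x => {subset F x <= flatten (map F s)}) s.
Proof.
elim: s => //= x s IH; split; first by move=> v h; rewrite mem_cat h.
by apply: Forall_seq_impl IH => y h v /h h'; rewrite mem_cat h' orbT.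
Qed.

Lemma Forall_seq_sumn (F : T -> nat) s : Forall_seq (fun x => F x <= sumn (map F s)) s.
Proof.
elim: s => //= x s IH; split; first exact: leq_addr.
by apply: Forall_seq_impl IH => y h; apply: leq_trans h (leq_addl _ _).
Qed.
End SeqPredicates.

Definition code (n : nat) : seq bool := rev (bits n n).
Definition decode (s : seq bool) : nat := foldr (fun (b : bool) n => b + n.*2) 0 (rev s).

(** Injectivity of the code lets constants be compared as words. The fuel [n] suffices because
    halving a nonzero number decreases it. *)
Lemma codeK : cancel code decode.
Proof.
move=> n; rewrite /decode /code revK; move: {-2}n (leqnn n).
suff: forall k m, m <= k -> foldr (fun (b : bool) n => b + n.*2) 0 (bits k m) = m by move=> h m _; apply: h.
elim=> [|k IH] m hm; first by case: m hm.
rewrite /=; case: eqP => [->//|/eqP m0] /=.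
by rewrite IH ?odd_double_half //; have := odd_double_half m; lia.
Qed.

(** With the predicate symbol as one more word, matching an atom is a mere comparison of words;
    being last, it does not shift the indices of the reversed arguments. *)
Definition fwords (f : fact) : seq nat := rev (f.1 :: f.2).

(* Where the value of a variable is found: in a word of a chosen fact, as a constant, or
   as the fresh value, which differs from all words and constants. *)
Inductive kind := KRef of nat * nat | KConst of nat | KFresh.

Definition eqk (k k' : kind) : form :=
  match k, k' with
  | KRef r, KRef r' => FEq r r'
  | KRef r, KConst c | KConst c, KRef r => FEqc r (code c)
  | KConst c, KConst c' => FBool (c == c')
  | KFresh, KFresh => FBool true
  | _, _ => FBool false
  end.
Definition exk (k : kind) : form := if k is KRef r then FEq r r else FBool true.
(** Comparison with a missing word is false, so its negation alone would count a missing word as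
    different. *)
Definition neqk (k k' : kind) : form := FAnd (exk k) (FAnd (exk k') (FNot (eqk k k'))).

Definition allF (fs : seq form) : form := foldr FAnd (FBool true) fs.
Definition anyF (fs : seq form) : form := FNot (allF (map FNot fs)).

Definition tkind (sg : nat -> kind) (t : term) : kind :=
  match t with Cst c => KConst c | Var v => sg v end.

Definition atomF sg i (us : seq term) : form :=
  FAnd (FLen i (size us))
    (allF [seq eqk (KRef (i, j)) (tkind sg (nth (Cst 0) us j)) | j <- iota 0 (size us)]).

Fixpoint conjF sg n (c : seq lit) : form :=
  match c with
  | [::] => FBool true
  | LAtom Bot _ :: _ => FBool false
  | LAtom (P p) ts :: c' => FAnd (atomF sg n (rev (Cst p :: ts))) (conjF sg n.+1 c')
  | LNeq t t' :: c' => FAnd (neqk (tkind sg t) (tkind sg t')) (conjF sg n c')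
  end.

Definition is_var v (t : term) : bool := if t is Var v' then v' == v else false.

Fixpoint occ n (c : seq lit) v : kind :=
  match c with
  | [::] => KFresh
  | LAtom _ ts :: c' =>
      if has (is_var v) (rev ts) then KRef (n, find (is_var v) (rev ts)) else occ n.+1 c' v
  | LNeq _ _ :: c' => occ n c' v
  end.

Definition cqF sg n (q : CQ) : form :=
  iter (count is_atom (cq_body q)) FEx
    (conjF (fun v => if v \in cq_ex q then occ n (cq_body q) v else sg v) n (cq_body q)).
Definition ucqF sg n (Q : UCQ) : form := anyF (map (cqF sg n) Q).

Definition term_csts (t : term) : seq nat := if t is Cst c then [:: c] else [::].
(** Only constants in inequalities matter here: a constant in an atom is compared with a word, which
    is never the fresh value. *)
Definition neq_csts (c : seq lit) : seq nat :=
  flatten (map (fun l => if l is LNeq t t' then term_csts t ++ term_csts t' else [::]) c).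

Definition updk (sg : nat -> kind) v k : nat -> kind := fun v' => if v' == v then k else sg v'.

(* [goal] holds for some choice of the kinds of the variables in [W]; [n] is the current level. *)
Fixpoint wF J (C : seq nat) (goal : (nat -> kind) -> nat -> form) (W : seq nat) sg n : form :=
  if W is v :: W' then
    anyF ([seq FEx (FAnd (FEq (n, j) (n, j)) (wF J C goal W' (updk sg v (KRef (n, j))) n.+1))
            | j <- iota 0 J] ++
          wF J C goal W' (updk sg v KFresh) n ::
          [seq wF J C goal W' (updk sg v (KConst c)) n | c <- C])
  else goal sg n.

Definition total_arity (c : seq lit) : nat :=
  sumn (map (fun l => if l is LAtom _ ts then size ts else 0) c).

(** Larger than the arity of every atom of [d]: a fact that matches one has all its words, the
    predicate symbol included, among the first [dep_width d]. *)
Definition dep_width (d : dep) : nat :=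
  (total_arity (dep_body d) + sumn [seq total_arity (cq_body q) | q <- dep_head d]).+1.
Definition dep_csts (d : dep) : seq nat :=
  neq_csts (dep_body d) ++ flatten [seq neq_csts (cq_body q) | q <- dep_head d].
Definition dep_loose (d : dep) : seq nat :=
  [seq v <- flatten (map cq_free_vars (dep_head d)) | v \notin conj_vars (dep_body d)].

(** Level 0 is left free for the single fact that matches the linear body, so quantified levels
    start at 1. *)
Definition violF (d : dep) : form :=
  let sg := occ 0 (dep_body d) in
  FAnd (conjF sg 0 (dep_body d))
    (wF (dep_width d) (dep_csts d) (fun sg n => FNot (ucqF sg n (dep_head d)))
       (dep_loose d) sg 1).

(** * Meaning of the formulas over the remaining facts *)

Section Semantics.
Variables (E : seq nat) (w : nat -> seq (seq bool)) (fa : nat -> fact) (N : nat).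
Hypothesis wE : forall x, x \in E -> w x = map code (fwords (fa x)).
Hypothesis hN : forall x, x \in E -> N \notin fwords (fa x).

Notation sat := (sat E w).
Notation onE := (all (fun x : nat => x \in E)).
Let I : interp := fun f => f \in map fa E.

Lemma sat_and env f g : sat env (FAnd f g) = sat env f && sat env g.
Proof. by []. Qed.

Lemma sat_allF env fs : sat env (allF fs) = all (sat env) fs.
Proof. by elim: fs => //= f fs ->. Qed.

Lemma sat_anyF env fs : sat env (anyF fs) = has (sat env) fs.
Proof. by rewrite /= sat_allF all_map -[RHS]negbK -all_predC. Qed.

Definition kv (env : seq nat) (k : kind) : option nat :=
  match k with
  | KRef r => if r.1 < size env then onth (fwords (fa (nth 0 env r.1))) r.2 else None
  | KConst c => Some c
  | KFresh => Some N
  end.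

Definition kok (k : kind) : bool := if k is KConst c then c != N else true.

Lemma deref_kv env r : onE env -> deref w env r = omap code (kv env (KRef r)).
Proof.
move=> /allP h; rewrite /deref /=; case: ifP => // hr.
by rewrite wE ?onth_map //; apply: h; rewrite mem_nth.
Qed.

Lemma kv_ref_fresh env r : onE env -> kv env (KRef r) != Some N.
Proof.
move=> /allP h /=; case: ifP => // hr.
have /hN : nth 0 env r.1 \in E by apply: h; rewrite mem_nth.
by move/onthPn; apply.
Qed.

Lemma code_eq (a b : option nat) : (omap code a == omap code b) = (a == b).
Proof.
case: a b => [a|] [b|] //=; apply/eqP/eqP => [[]|[->]//].
by move/(can_inj codeK) => ->.
Qed.

Lemma sat_eqk_ref env r k : onE env ->
  sat env (eqk (KRef r) k) = isSome (kv env (KRef r)) && (kv env (KRef r) == kv env k).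
Proof.
move=> hE; have hf := kv_ref_fresh r hE; case: k => [r'|c|]; rewrite [eqk _ _]/=.
- rewrite [sat _ _]/= !deref_kv // code_eq; by case: (kv env (KRef r)).
- rewrite [sat _ _]/= deref_kv // -[Some (code c)]/(omap code (Some c)) code_eq.
  by rewrite [kv env (KConst c)]/=; case: (kv env (KRef r)).
- by rewrite [kv env KFresh]/= (negbTE hf) andbF.
Qed.

Lemma sat_eqk env k k' : onE env -> kok k -> kok k' ->
  sat env (eqk k k') = isSome (kv env k) && (kv env k == kv env k').
Proof.
move=> hE; case: k k' => [r|c|] k'; first by move=> _ _; apply: sat_eqk_ref.
- case: k' => [r|c'|] /= h1 h2 //; last first.
    by apply/esym/eqP => -[e]; rewrite e eqxx in h1.
  by have := @sat_eqk_ref env r (KConst c) hE; rewrite /= => ->; rewrite eq_sym; case: (if _ then _ else _).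
- case: k' => [r|c'|] /= h1 h2.
  + by have := kv_ref_fresh r hE; rewrite eq_sym /= => /negbTE ->.
  + by apply/esym/eqP => -[e]; rewrite e eqxx in h2.
  + by rewrite eqxx.
Qed.

Lemma sat_exk env k : onE env -> sat env (exk k) = isSome (kv env k).
Proof.
move=> hE; case: k => // r; rewrite /exk.
by have -> := @sat_eqk_ref env r (KRef r) hE; rewrite eqxx andbT.
Qed.

Lemma sat_neqk env k k' : onE env -> kok k -> kok k' ->
  sat env (neqk k k') = [&& isSome (kv env k), isSome (kv env k') & kv env k != kv env k'].
Proof.
move=> hE h h'; rewrite /neqk /= -!/(sat _ _) !sat_exk // sat_eqk //.
by case: (kv env k).
Qed.

Lemma sat_atomF sg env i us : onE env ->
  sat env (atomF sg i us) =
  (i < size env) && (map Some (fwords (fa (nth 0 env i))) == map (fun t => kv env (tkind sg t)) us).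
Proof.
move=> hE; rewrite /atomF [sat _ _]/= -/(sat _ _) sat_allF all_map.
case: (ltnP i (size env)) => //= hi.
have xE : nth 0 env i \in E by move/allP: hE; apply; rewrite mem_nth.
rewrite wE // size_map; set ws := fwords _.
have se j : preim (fun j => eqk (KRef (i, j)) (tkind sg (nth (Cst 0) us j))) (sat env) j =
  isSome (onth ws j) && (onth ws j == kv env (tkind sg (nth (Cst 0) us j))).
  by rewrite /= sat_eqk_ref //= hi.
rewrite (eq_all se).
apply/andP/eqP => [[/eqP es /allP h]|e].
  apply: (@eq_from_nth _ None); rewrite !size_map // => j hj.
  have := h j; rewrite mem_iota add0n -es hj => /(_ isT) /andP[_ /eqP].
  by rewrite onthE => ->; rewrite (nth_map (Cst 0)) // -es.
have es : size ws = size us by rewrite -(size_map Some) e size_map.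
rewrite es; split=> //; apply/allP => j; rewrite mem_iota add0n => hj.
rewrite onthE e (nth_map (Cst 0)) //.
have := congr1 (fun l => nth None l j) e; rewrite (nth_map 0) ?es // (nth_map (Cst 0)) // => <-.
by rewrite eqxx.
Qed.

Definition nuk env (sg : nat -> kind) (v : nat) : nat := odflt 0 (kv env (sg v)).

Lemma map_kv env sg l (ts : seq term) :
  map Some l = map (fun t => kv env (tkind sg t)) ts ->
  l = map (eval (nuk env sg)) ts /\
  forall v, v \in flatten (map term_vars ts) -> isSome (kv env (sg v)).
Proof.
elim: ts l => [|t ts IH] [|a l] //= [e /IH [-> h]].
have ea : a = eval (nuk env sg) t by case: t e => [c|v] /= e; [case: e | rewrite /nuk -e].
split; first by rewrite ea.
move=> v; rewrite mem_cat => /orP[|]; last exact: h.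
by case: t e {ea} => //= v' e; rewrite inE => /eqP ->; rewrite -e.
Qed.

Lemma conjF_sound sg env n c : onE env -> (forall v, kok (sg v)) -> N \notin neq_csts c ->
  sat env (conjF sg n c) ->
  holds_conj (fun f => f \in map fa env) (nuk env sg) c /\
  forall v, v \in conj_vars c -> isSome (kv env (sg v)).
Proof.
move=> hE hsg; elim: c n => [|l c IH] n //.
have kt t : N \notin term_csts t -> kok (tkind sg t).
  by case: t => //= a; rewrite inE eq_sym.
case: l => [[|p] ts|t t'] hc //; rewrite [conjF _ _ _]/= sat_and.
  rewrite sat_atomF // => /andP[/andP[hn /eqP e] /(IH n.+1 hc) [h1 h2]].
  move: e; rewrite /fwords !map_rev => /(can_inj revK); rewrite [in RHS]/=.
  move=> [e1 /map_kv [e2 h3]]; split.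
    split=> //=; apply/mapP; exists (nth 0 env n); first by rewrite mem_nth.
    by case: (fa _) e1 e2 => [p' a] /= -> ->.
  by move=> v; rewrite /conj_vars /= mem_cat => /orP[/h3|/h2].
rewrite /neq_csts /= !mem_cat !negb_or in hc; case/andP: hc => /andP[/kt k1 /kt k2] hc.
rewrite sat_neqk // => /andP[/and3P[s1 s2 ne] /(IH n hc) [h1 h2]].
have ev s : isSome (kv env (tkind sg s)) -> kv env (tkind sg s) = Some (eval (nuk env sg) s).
  by case: s => //= v; rewrite /nuk; case: (kv _ _).
split.
  split=> //=; move/eqP: ne; rewrite (ev t) // (ev t') // => ne e; apply: ne; by rewrite e.
move=> v; rewrite /conj_vars /= !mem_cat => /orP[/orP[]|/h2 //].
  by case: t s1 {k1 ne ev} => //= v' s1; rewrite inE => /eqP ->.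
by case: t' s2 {k2 ne ev} => //= v' s2; rewrite inE => /eqP ->.
Qed.

(** Compared with [holds_conj], the witness of each atom is named, at the level where [conjF] looks
    for it. *)
Fixpoint matched env n nu (c : seq lit) : Prop :=
  match c with
  | [::] => True
  | LAtom Bot _ :: _ => False
  | LAtom (P p) ts :: c' =>
      [/\ n < size env, fa (nth 0 env n) = (p, map (eval nu) ts) & matched env n.+1 nu c']
  | LNeq t t' :: c' => eval nu t <> eval nu t' /\ matched env n nu c'
  end.

Lemma conjF_complete sg env n nu c : onE env -> (forall v, kok (sg v)) -> N \notin neq_csts c ->
  matched env n nu c -> (forall v, v \in conj_vars c -> kv env (sg v) = Some (nu v)) ->
  sat env (conjF sg n c).
Proof.
move=> hE hsg; elim: c n => [|l c IH] n //.
have kt t : N \notin term_csts t -> kok (tkind sg t).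
  by case: t => //= a; rewrite inE eq_sym.
case: l => [[|p] ts|t t'] hc //; rewrite [conjF _ _ _]/= sat_and.
  case=> hn hf hm hv; rewrite sat_atomF // hn hf IH //; last first.
    by move=> v hv'; apply: hv; rewrite /conj_vars /= mem_cat hv' orbT.
  rewrite andbT; apply/eqP; rewrite /fwords !map_rev /=; congr (rev (_ :: _)).
  rewrite -map_comp.
  have {hv}: forall v, v \in flatten (map term_vars ts) -> kv env (sg v) = Some (nu v).
    by move=> v hv'; apply: hv; rewrite /conj_vars /= mem_cat hv'.
  elim: ts {hf hc} => //= t ts IHt hv; rewrite -IHt; last first.
    by move=> v hv'; apply: hv; rewrite mem_cat hv' orbT.
  congr (_ :: _); case: t hv => //= v hv; rewrite hv ?mem_cat ?inE ?eqxx //.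
rewrite /neq_csts /= !mem_cat !negb_or in hc; case/andP: hc => /andP[/kt k1 /kt k2] hc.
case=> ne hm hv; rewrite sat_neqk // IH //; last first.
  by move=> v hv'; apply: hv; rewrite /conj_vars /= mem_cat hv' orbT.
have ev s : (forall v, v \in term_vars s -> v \in conj_vars (LNeq t t' :: c)) ->
   kv env (tkind sg s) = Some (eval nu s).
  by case: s => //= v h; rewrite hv // h // inE eqxx.
rewrite (ev t) ?(ev t') /=.
- by rewrite andbT; apply/eqP => -[].
- by move=> v h; rewrite /conj_vars /= !mem_cat h orbT.
- by move=> v h; rewrite /conj_vars /= !mem_cat h.
Qed.

Lemma has_is_var v (ts : seq term) : (v \in flatten (map term_vars ts)) = has (is_var v) ts.
Proof.
elim: ts => //= t ts <-; rewrite mem_cat; congr orb.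
by case: t => //= v'; rewrite inE eq_sym.
Qed.

Lemma matched_occ env n nu c v : matched env n nu c -> v \in atom_vars c ->
  kv env (occ n c v) = Some (nu v).
Proof.
elim: c n => [|[[|p] ts|t t'] c IH] n //=.
  case=> hn hf hm; rewrite /atom_vars /= mem_cat has_is_var has_rev.
  case: ifP => [hv _|_]; last exact: IH hm.
  have hv' : has (is_var v) (rev ts) by rewrite has_rev.
  rewrite /= hn hf /fwords rev_cons -map_rev -cats1 onth_cat size_map -has_find hv'.
  rewrite onth_map onthE (nth_map (Cst 0)) -?has_find //=; congr Some.
  by have := nth_find (Cst 0) hv'; case: (nth _ _ _) => //= v' /eqP ->.
by case=> _ hm hv; apply: IH hm _.
Qed.

Lemma kok_occ n c v : kok (occ n c v).
Proof.
by elim: c n => [|[p ts|t t'] c IH] n //=; case: ifP.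
Qed.

Lemma holds_matched nu c env : holds_conj I nu c -> exists xs,
  [/\ size xs = count is_atom c, onE xs & matched (env ++ xs) (size env) nu c].
Proof.
elim: c env => [|[[|p] ts|t t'] c IH] env; rewrite /holds_conj /=; last 1 first.
- case=> ne /(IH env) [xs [h1 h2 h3]]; by exists xs.
- by exists [::].
- by case.
case=> /mapP [x xE e] /(IH (rcons env x)) [xs [h1 h2 h3]].
exists (x :: xs); split=> /=; first by rewrite h1.
  by rewrite xE.
rewrite size_rcons cat_rcons in h3; split=> //.
  by rewrite size_cat /=; lia.
by rewrite nth_cat ltnn subnn.
Qed.

Lemma sat_exF m env f : reflect
  (exists xs, [/\ size xs = m, onE xs & sat (env ++ xs) f]) (sat env (iter m FEx f)).
Proof.
elim: m env => [|m IH] env /=.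
  apply: (iffP idP) => [h|[xs [/size0nil -> _]]]; last by rewrite cats0.
  by exists [::]; rewrite cats0.
apply: (iffP hasP) => [[x xE /IH [xs [h1 h2 h3]]]|[[|x xs] []//= [h1] /andP[h2 h2'] h3]].
  by exists (x :: xs); rewrite -cat_rcons /= xE h1.
by exists x => //; apply/IH; exists xs; rewrite cat_rcons.
Qed.

(** Levels are counted from the bottom of the stack, so references keep their value when the stack
    grows. *)
Lemma kv_cat env xs k a : kv env k = Some a -> kv (env ++ xs) k = Some a.
Proof.
case: k => //= r; case: ifP => // hr h; rewrite size_cat nth_cat hr.
by have -> : r.1 < size env + size xs by lia.
Qed.

Lemma holds_conj_ext (I1 I2 : interp) nu nu' c : (forall f, I1 f -> I2 f) ->
  (forall v, v \in conj_vars c -> nu v = nu' v) ->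
  holds_conj I1 nu c -> holds_conj I2 nu' c.
Proof.
move=> hI; rewrite /holds_conj; elim: c => //= l c IH hv [h1 h2]; split; last first.
  by apply: IH h2 => v h; apply: hv; rewrite /conj_vars /= mem_cat h orbT.
have {}hv v : v \in lit_vars l -> nu v = nu' v.
  by move=> h; apply: hv; rewrite /conj_vars /= mem_cat h.
have evs t : (forall v, v \in term_vars t -> nu v = nu' v) -> eval nu t = eval nu' t.
  by case: t => //= v; apply; rewrite inE.
case: l h1 hv => [[|p] ts|t t'] //= h1 hv.
  have <- : map (eval nu) ts = map (eval nu') ts; last exact: hI.
  elim: ts hv {h1} => //= t ts IHt hv; rewrite IHt; last first.
    by move=> v h; apply: hv; rewrite mem_cat h orbT.
  by rewrite evs // => v h; apply: hv; rewrite mem_cat h.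
rewrite -!evs // => v h; apply: hv; rewrite mem_cat h ?orbT //.
Qed.

Definition cq_ready env sg nu (q : CQ) : Prop :=
  [/\ N \notin neq_csts (cq_body q),
      forall v, v \in conj_vars (cq_body q) -> v \in cq_ex q -> v \in atom_vars (cq_body q) &
      forall v, v \in conj_vars (cq_body q) -> v \notin cq_ex q -> kv env (sg v) = Some (nu v)].

Lemma cqF_correct env sg nu q : onE env -> (forall v, kok (sg v)) -> cq_ready env sg nu q ->
  sat env (cqF sg (size env) q) <-> sat_CQ I nu q.
Proof.
move=> hE hsg [hN' hex hfree].
set sg' := fun v => if v \in cq_ex q then occ (size env) (cq_body q) v else sg v.
have hsg' v : kok (sg' v) by rewrite /sg'; case: ifP => // _; apply: kok_occ.
split.
  move/sat_exF => [xs [h1 h2]].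
  have hE' : onE (env ++ xs) by rewrite all_cat hE.
  move/(conjF_sound hE' hsg' hN') => [h3 _].
  exists (fun v => if v \in cq_ex q then nuk (env ++ xs) sg' v else nu v); split.
    by move=> v /negbTE ->.
  apply: holds_conj_ext h3.
    move=> f /mapP[x hx ->]; apply: map_f; by move/allP: hE'; apply.
  move=> v hv; case: ifP => // /negbT hn.
  by rewrite /nuk /sg' (negbTE hn) (kv_cat _ (hfree v hv hn)).
case=> nu' [h1 /(holds_matched env) [xs [h2 h3 h4]]].
have hE' : onE (env ++ xs) by rewrite all_cat hE.
apply/sat_exF; exists xs; split=> //.
apply: (conjF_complete (nu := nu')) => // v hv; rewrite -/sg' /sg'; case: ifP => [hx|/negbT hx].
  by apply: matched_occ h4 _; apply: hex.
by rewrite h1 //; apply: kv_cat; apply: hfree.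
Qed.

Lemma ucqF_correct env sg nu Q : onE env -> (forall v, kok (sg v)) ->
  Forall_seq (cq_ready env sg nu) Q ->
  sat env (ucqF sg (size env) Q) <-> sat_UCQ I nu Q.
Proof.
move=> hE hsg; rewrite /ucqF sat_anyF has_map /sat_UCQ.
elim: Q => //= q Q IH [h1 h2].
by rewrite -(cqF_correct hE hsg h1) -(IH h2); split=> [/orP|/orP].
Qed.

Section Loose.
Variables (J : nat) (C : seq nat) (goal : (nat -> kind) -> nat -> form).
Hypothesis NC : N \notin C.

Lemma kok_updk sg v k : (forall v, kok (sg v)) -> kok k -> forall v', kok (updk sg v k v').
Proof. by move=> h1 h2 v'; rewrite /updk; case: ifP. Qed.

Lemma kok_const c : c \in C -> kok (KConst c).
Proof. by move=> h; apply: contraNneq NC => <-. Qed.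

Lemma wF_sound W sg env : onE env -> (forall v, kok (sg v)) ->
  sat env (wF J C goal W sg (size env)) -> exists xs sg',
  [/\ onE (env ++ xs), forall v, kok (sg' v), forall v, v \notin W -> sg' v = sg v,
      forall v, v \in W -> isSome (kv (env ++ xs) (sg' v)) &
      sat (env ++ xs) (goal sg' (size (env ++ xs)))].
Proof.
elim: W sg env => [|v W IH] sg env hE hsg.
  by move=> h; exists [::], sg; rewrite cats0.
have step env' xs k sg' : onE (env' ++ xs) -> isSome (kv env' k) ->
  (forall u, u \notin W -> sg' u = updk sg v k u) ->
  (forall u, u \in W -> isSome (kv (env' ++ xs) (sg' u))) ->
  (forall u, u \notin v :: W -> sg' u = sg u) /\
  (forall u, u \in v :: W -> isSome (kv (env' ++ xs) (sg' u))).
  move=> h1 h2 h3 h4; split=> u; rewrite inE ?negb_or.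
    by case/andP=> /negbTE uv uW; rewrite h3 // /updk uv.
  (* [W] may list a variable several times; the last choice prevails. *)
  case uW: (u \in W); first by rewrite h4.
  rewrite orbF => /eqP eu; rewrite h3 ?uW // /updk eu eqxx.
  by case ek: (kv env' k) h2 => // _; rewrite (kv_cat _ ek).
rewrite [wF _ _ _ _ _ _]/= sat_anyF has_cat => /orP[].
  rewrite has_map => /hasP[j _] /= /hasP [x xE] /andP[/andP[hx _]].
  have hE' : onE (rcons env x) by rewrite all_rcons xE.
  rewrite -(size_rcons env x) -/(sat _ _) => /(IH _ _ hE') [|xs [sg' [h1 h2 h3 h4 h5]]].
    exact: kok_updk.
  have hk : isSome (kv (rcons env x) (KRef (size env, j))).
    by move: hx; rewrite deref_kv //; case: (kv _ _).
  have [a b] := step _ _ _ _ h1 hk h3 h4.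
  by exists (x :: xs), sg'; rewrite -cat_rcons; split.
rewrite /= has_map => /orP[|/hasP[c cC]] /= /(IH _ _ hE) [|xs [sg' [h1 h2 h3 h4 h5]]].
- exact: kok_updk.
- have [a b] := step _ _ KFresh _ h1 isT h3 h4.
  by exists xs, sg'.
- by apply: kok_updk => //; apply: kok_const.
- have [a b] := step _ _ (KConst c) _ h1 isT h3 h4.
  by exists xs, sg'.
Qed.

Lemma wF_complete W sg env nu : onE env -> (forall v, kok (sg v)) ->
  (forall v, v \in W -> [\/ nu v = N, nu v \in C |
     exists2 x, x \in E & exists2 j, j < J & onth (fwords (fa x)) j = Some (nu v)]) ->
  (forall xs sg', onE (env ++ xs) -> (forall v, kok (sg' v)) ->
     (forall v, v \notin W -> sg' v = sg v) ->
     (forall v, v \in W -> kv (env ++ xs) (sg' v) = Some (nu v)) ->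
     sat (env ++ xs) (goal sg' (size (env ++ xs)))) ->
  sat env (wF J C goal W sg (size env)).
Proof.
elim: W sg env => [|v W IH] sg env hE hsg hW hg.
  by have := hg [::] sg; rewrite cats0; apply.
have step env' xs k sg' : kv env' k = Some (nu v) ->
  (forall u, u \notin W -> sg' u = updk sg v k u) ->
  (forall u, u \in W -> kv (env' ++ xs) (sg' u) = Some (nu u)) ->
  (forall u, u \notin v :: W -> sg' u = sg u) /\
  (forall u, u \in v :: W -> kv (env' ++ xs) (sg' u) = Some (nu u)).
  move=> h2 h3 h4; split=> u; rewrite inE ?negb_or.
    by case/andP=> /negbTE uv uW; rewrite h3 // /updk uv.
  case uW: (u \in W); first by rewrite h4.
  rewrite orbF => /eqP eu; rewrite h3 ?uW // /updk eu eqxx.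
  by rewrite (kv_cat _ h2).
have hW' u : u \in W -> [\/ nu u = N, nu u \in C |
     exists2 x, x \in E & exists2 j, j < J & onth (fwords (fa x)) j = Some (nu u)].
  by move=> h; apply: hW; rewrite inE h orbT.
rewrite [wF _ _ _ _ _ _]/= sat_anyF has_cat /= !has_map.
case: (hW v (mem_head v W)) => [e|hC|[x xE [j jJ ej]]].
- apply/or3P/Or32; apply: IH => // [|xs sg' h1 h2 h3 h4]; first exact: kok_updk.
  by have [|a b] := @step env xs KFresh sg' _ h3 h4; [rewrite /= e | apply: hg].
- apply/or3P/Or33/hasP; exists (nu v) => //=; apply: IH => // [|xs sg' h1 h2 h3 h4].
    by apply: kok_updk => //; apply: kok_const.
  by have [a b] := @step env xs (KConst (nu v)) sg' erefl h3 h4; apply: hg.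
- apply/or3P/Or31/hasP; exists j; first by rewrite mem_iota.
  apply/hasP; exists x => //=.
  have hE' : onE (rcons env x) by rewrite all_rcons xE.
  have ek : kv (rcons env x) (KRef (size env, j)) = Some (nu v).
    by rewrite /= size_rcons leqnn nth_rcons ltnn eqxx.
  rewrite deref_kv // ek eqxx /= -/(sat _ _) -(size_rcons env x).
  apply: IH => // [|xs sg' h1 h2 h3 h4]; first exact: kok_updk.
  have [a b] := @step _ xs _ sg' ek h3 h4.
  by rewrite cat_rcons in h1 b *; apply: hg.
Qed.
End Loose.

(* Identifying all values outside [V] with the single value [N] preserves the
   failure of a head: it only destroys inequalities, and atoms only hold of values in [V]. *)
Section Collapse.
Variables (J : nat) (V : pred nat).
Hypothesis hV : forall f, I f -> size f.2 < J -> all V f.2.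
Hypothesis VN : ~~ V N.

Definition collapse (x : nat) : nat := if V x then x else N.

Lemma holds_V nu c : total_arity c < J -> holds_conj I nu c ->
  forall v, v \in atom_vars c -> V (nu v).
Proof.
rewrite /total_arity /holds_conj /atom_vars.
elim: c => [|l c IH] //= hJ [h1 h2] v; rewrite mem_cat => /orP[|]; last first.
  by apply: IH h2 _; apply: leq_ltn_trans hJ; apply: leq_addl.
case: l h1 hJ => [[|p] ts|] //= /hV; rewrite size_map => h hJ.
have /allP {}h := h (leq_ltn_trans (leq_addr _ _) hJ).
rewrite has_is_var => hv; apply: h; rewrite /=.
elim: ts hv {hJ} => //= t ts IHt /orP[|/IHt]; last by rewrite inE => ->; rewrite orbT.
by case: t => //= v' /eqP ->; rewrite inE eqxx.
Qed.

Lemma collapse_CQ nu q : total_arity (cq_body q) < J -> all V (neq_csts (cq_body q)) ->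
  (forall v, v \in cq_ex q -> v \in atom_vars (cq_body q)) ->
  sat_CQ I (collapse \o nu) q -> sat_CQ I nu q.
Proof.
move=> hJ hc hex [nu2 [h1 h2]].
pose nu3 v := if v \in cq_ex q then nu2 v else nu v.
exists nu3; split; first by move=> v /negbTE; rewrite /nu3 => ->.
have hA := holds_V hJ h2.
(* A free variable in an atom has its collapsed value in [V]; that value is not [N], so collapsing
   did not change it. *)
have eA v : v \in atom_vars (cq_body q) -> nu3 v = nu2 v.
  move=> hv; have := hA v hv; rewrite /nu3; case: ifP => // /negbT hx.
  by rewrite h1 //= /collapse; case: ifP => // _; rewrite (negbTE VN).
(* [nu2] is the collapse of [nu3] on terms, so two terms that differ under [nu2] differ under
   [nu3]. *)
have eN t : all V (term_csts t) -> eval nu2 t = collapse (eval nu3 t).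
  case: t => [c|v] /=; first by rewrite andbT /collapse => ->.
  move=> _; rewrite /nu3; case: ifP => [hx|/negbT hx]; last exact: h1.
  by rewrite /collapse hA //; apply: hex.
move: (cq_body q) hc h2 eA {hA hJ hex}; rewrite /holds_conj /atom_vars /neq_csts.
elim=> [|l c IH] //= hc [h2 h3] hA; split; last first.
  apply: IH h3 _; first by move: hc; rewrite all_cat => /andP[].
  by move=> v hv; apply: hA; rewrite mem_cat hv orbT.
case: l h2 hc hA => [[|p] ts|t t'] //=.
  move=> h2 _ hA; have -> // : map (eval nu3) ts = map (eval nu2) ts.
  have {hA}: forall v, v \in flatten (map term_vars ts) -> nu3 v = nu2 v.
    by move=> v hv; apply: hA; rewrite mem_cat hv.
  elim: ts {h2} => //= t ts IHt hv; rewrite IHt; last first.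
    by move=> v h; apply: hv; rewrite mem_cat h orbT.
  by congr (_ :: _); case: t hv => //= v hv; apply: hv; rewrite inE eqxx.
rewrite !all_cat => h2 /andP[/andP[c1 c2] _] _ e; apply: h2.
by rewrite (eN t) // (eN t') // e.
Qed.
End Collapse.

Section Dependency.
Variables (ar : nat -> nat) (d : dep).
Hypothesis wf_d : dep_wf ar d.
Hypothesis lin_d : linear_dep d.
Hypothesis hd : N \notin dep_csts d.

Lemma body_csts : N \notin neq_csts (dep_body d).
Proof. by apply: contra hd; rewrite mem_cat => ->. Qed.

Lemma head_ready env sg nu :
  (forall v, v \in conj_vars (dep_body d) -> kv env (sg v) = Some (nu v)) ->
  (forall v, v \in dep_loose d -> kv env (sg v) = Some (nu v)) ->
  Forall_seq (cq_ready env sg nu) (dep_head d).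
Proof.
move=> h1 h2; case: wf_d => _ [_ h3].
have := Forall_seq_and h3 (Forall_seq_and
  (Forall_seq_flatten cq_free_vars (dep_head d))
  (Forall_seq_flatten (fun q => neq_csts (cq_body q)) (dep_head d))).
apply: Forall_seq_impl => q [[_ [_ hx]] [hf hc]]; split.
- by apply: contra hd => /hc h; rewrite mem_cat h orbT.
- by move=> v _; apply: hx.
- move=> v hv hv'; case hb : (v \in conj_vars (dep_body d)); first exact: h1.
  apply: h2; rewrite mem_filter hb /=; apply: hf.
  by rewrite mem_filter hv'.
Qed.

Lemma violF_sound x : x \in E -> sat [:: x] (violF d) ->
  exists2 nu, holds_conj (fun f => f = fa x) nu (dep_body d) & ~ sat_UCQ I nu (dep_head d).
Proof.
move=> xE; have hE : onE [:: x] by rewrite /= xE.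
have ko v : kok (occ 0 (dep_body d) v) by apply: kok_occ.
rewrite /violF sat_and => /andP[/(conjF_sound hE ko body_csts) [h1 h2]].
move/(wF_sound hd hE ko) => [xs [sg' [h3 h4 h5 h6 h7]]].
have bodykv v : v \in conj_vars (dep_body d) -> sg' v = occ 0 (dep_body d) v.
  by move=> hv; apply: h5; rewrite mem_filter hv.
exists (nuk ([:: x] ++ xs) sg').
  apply: holds_conj_ext h1; first by move=> f; rewrite /= inE => /eqP.
  move=> v hv; rewrite /nuk bodykv //.
  by case e: (kv [:: x] _) (h2 v hv) => // _; rewrite (kv_cat _ e).
apply/(ucqF_correct h3 h4); last exact/negP.
have some v : isSome (kv ([:: x] ++ xs) (sg' v)) ->
  kv ([:: x] ++ xs) (sg' v) = Some (nuk ([:: x] ++ xs) sg' v).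
  by rewrite /nuk; case: (kv _ _).
apply: head_ready => v hv; apply: some; last exact: h6.
by rewrite bodykv //; case e: (kv [:: x] _) (h2 v hv) => // _; rewrite (kv_cat _ e).
Qed.

(** A violation is first collapsed: its body only takes values in [V] and is unchanged, and its head
    still fails. Afterwards every value is one that [wF] can choose, so some fact satisfies
    [violF d]. *)
Lemma violF_complete : (forall x, x \in E -> ~~ sat [:: x] (violF d)) -> sat_dep I d.
Proof.
move=> hviol nu hb; apply: NNPP => nh.
pose J := dep_width d.
pose V v := (v \in dep_csts d) || has (fun x => v \in take J (fwords (fa x))) E.
have VN : ~~ V N.
  rewrite /V negb_or hd; apply/hasPn => x /hN; apply: contra; exact: mem_take.
have hV f : I f -> size f.2 < J -> all V f.2.
  case/mapP=> x xE -> hJ; apply/allP => v hv; apply/orP; right; apply/hasP; exists x => //.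
  by rewrite take_oversize ?size_rev // mem_rev inE hv orbT.
have hJb : total_arity (dep_body d) < J by rewrite ltnS leq_addr.
case: (wf_d) => _ [hbv hw].
have bV v : v \in conj_vars (dep_body d) -> V (nu v).
  by case/hbv=> _; apply: (holds_V hV hJb hb).
pose nu' := collapse V \o nu.
have hb' : holds_conj I nu' (dep_body d).
  by apply: holds_conj_ext hb => // v /bV h; rewrite /nu' /= /collapse h.
have nh' : ~ sat_UCQ I nu' (dep_head d).
  move=> h; apply: nh; apply: Exists_seq_impl h.
  have := Forall_seq_and hw (Forall_seq_and
    (Forall_seq_flatten (fun q => neq_csts (cq_body q)) (dep_head d))
    (Forall_seq_sumn (fun q => total_arity (cq_body q)) (dep_head d))).
  apply: Forall_seq_impl => q [[_ [_ hx]] [hc hs]]; apply: (collapse_CQ hV VN) => //.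
    by rewrite ltnS; apply: leq_trans hs (leq_addl _ _).
  by apply/allP => v /hc hv; rewrite /V mem_cat hv orbT.
have [xs [hs hE hm]] := holds_matched [::] hb'.
rewrite lin_d in hs; case: xs hs hE hm => [|x [|? ?]] //= _ /andP[xE _] hm.
have hE : onE [:: x] by rewrite /= xE.
have ko v : kok (occ 0 (dep_body d) v) by apply: kok_occ.
have hocc v : v \in conj_vars (dep_body d) ->
    kv [:: x] (occ 0 (dep_body d) v) = Some (nu' v).
  by case/hbv=> _; apply: matched_occ hm.
have /negP := hviol x xE; apply; rewrite /violF sat_and; apply/andP; split.
  by apply: (conjF_complete hE ko body_csts hm).
apply: (@wF_complete _ _ _ hd _ _ [:: x] nu') => // [v _|xs sg' h1 h2 h3 h4].
  rewrite /nu' /= /collapse; case: ifP => [|_]; last by apply: Or31.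
  case/orP=> [h|/hasP[y yE h]]; first exact: Or32.
  apply: Or33; exists y => //; case/(nthP 0): h => j; rewrite size_take_min leq_min => /andP[j1 j2] <-.
  by exists j => //; rewrite nth_take // onthE (nth_map 0).
apply/negP => /(ucqF_correct h1 h2) h; apply: nh'; apply: h.
apply: head_ready => v hv; last exact: h4.
by rewrite h3 ?mem_filter ?hv //; apply: kv_cat; apply: hocc.
Qed.
End Dependency.
End Semantics.

(** * Polynomial bounds *)

Definition poly_bounded (f : nat -> nat) := exists k, forall n, f n <= k * n.+1 ^ k.

Lemma poly_cst c : poly_bounded (fun _ => c).
Proof. by exists c => n; rewrite leq_pmulr // expn_gt0. Qed.

Lemma poly_id : poly_bounded id.
Proof. by exists 1 => n; rewrite expn1; lia. Qed.

Lemma poly_add f g : poly_bounded f -> poly_bounded g -> poly_bounded (fun n => f n + g n).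
Proof.
move=> [k hk] [l hl]; exists (k + l) => n; rewrite mulnDl.
by apply: leq_add; [apply: leq_trans (hk n) _ | apply: leq_trans (hl n) _];
  rewrite leq_mul2l leq_pexp2l ?leq_addr ?leq_addl ?orbT.
Qed.

Lemma poly_mul f g : poly_bounded f -> poly_bounded g -> poly_bounded (fun n => f n * g n).
Proof.
move=> [k hk] [l hl]; exists (k * l + (k + l)) => n.
apply: leq_trans (leq_mul (hk n) (hl n)) _.
rewrite mulnACA -expnD; apply: leq_mul; first exact: leq_addr.
by rewrite leq_pexp2l // leq_addl.
Qed.

Lemma poly_fcost f : poly_bounded (fcost f).
Proof.
elim: f => [b|r r'|r c|i n|f IH|f IHf g IHg|f IH] /=.
all: do ?[exact: poly_id | exact: poly_cst | assumption | apply: poly_add | apply: poly_mul].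
Qed.

(** * The unique repair *)

(** No equality test is set up on dependencies, so membership of [x] in [s] is expressed by saying
    that [x] has every property shared by all entries of [s]. *)
Lemma Forall_seq_intro (T : Type) (B : T -> Prop) s :
  (forall x, (forall A, Forall_seq A s -> A x) -> B x) -> Forall_seq B s.
Proof.
elim: s => //= x s IH h; split; first by apply: h => A [].
by apply: IH => y hy; apply: h => A [_]; apply: hy.
Qed.

Lemma has_witness (T : Type) (p : pred T) s : has p s ->
  exists2 x, p x & forall A, Forall_seq A s -> A x.
Proof.
elim: s => //= x s IH /orP[px|/IH [y py hy]]; first by exists x => // A [].
by exists y => // A [_]; apply: hy.
Qed.

Lemma linear_holds (I : interp) nu c : count is_atom c = 1 -> holds_conj I nu c ->
  exists2 f, I f & holds_conj (fun g => g = f) nu c.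
Proof.
have none J J' c' : count is_atom c' = 0 -> holds_conj J nu c' -> holds_conj J' nu c'.
  by rewrite /holds_conj; elim: c' => //= -[[|p] ts|t t'] c' IH //= h [h1 h2]; split; auto.
rewrite /holds_conj; elim: c => //= -[[|p] ts|t t'] c IH //=.
- by move=> _ [].
- case=> h0 [h1 h2]; eexists; first exact: h1.
  by split=> //; apply: none h0 h2.
- by move=> h [h1 /(IH h) [f f1 f2]]; exists f.
Qed.

(** Atoms occur only positively, and inequalities do not depend on the facts. *)
Lemma sat_UCQ_mono (I I' : interp) nu Q : (forall f, I f -> I' f) ->
  sat_UCQ I nu Q -> sat_UCQ I' nu Q.
Proof.
move=> h; apply: Exists_seq_impl; apply: Forall_seq_intro => q _ [nu' [h1 h2]].
by exists nu'; split=> //; apply: holds_conj_ext h2.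
Qed.

Section Repair.
Variables (ar : nat -> nat) (Sigma : seq dep) (D : seq fact).
Hypothesis wfS : Forall_seq (fun d => dep_wf ar d /\ linear_dep d) Sigma.

Definition the_repair : interp := fun f => exists R : interp,
  [/\ forall g, R g -> g \in D, consistent R Sigma & R f].

Lemma the_repair_consistent : consistent the_repair Sigma.
Proof.
apply: Forall_seq_intro => d hd nu hb.
have [_ hl] := hd _ wfS.
have [f [R [h1 h2 h3]] hf] := linear_holds hl hb.
apply: (@sat_UCQ_mono R); first by move=> g hg; exists R.
by apply: (hd _ h2); apply: holds_conj_ext hf => // g ->.
Qed.

Lemma the_repairP : is_repair Sigma D the_repair.
Proof.
split; first by move=> f [R [h1 _ h3]]; apply: h1.
split; first exact: the_repair_consistent.
by move=> R' _ h1 h2 f hf; exists R'.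
Qed.

(** Every repair lies inside the consistent set [the_repair], so maximality makes it contain that
    set; the intersection of all repairs is therefore [the_repair] itself. *)
Lemma IAR_the_repair Q : IAR_entails Sigma D Q <-> sat_UCQ the_repair (fun _ => 0) Q.
Proof.
split; apply: sat_UCQ_mono => f; first by case=> _; apply; apply: the_repairP.
move=> hf; split; first by case: hf => R [h1 _ h3]; apply: h1.
move=> R [h1 [h2 h3]]; apply: h3 hf; last exact: the_repair_consistent.
  by move=> g hg; exists R.
by move=> g [R' [h _ h']]; apply: h.
Qed.

(** * Deleting violating facts until the repair is left *)

Section Elimination.
Variables (B : seq sym) (fa : nat -> fact).
Let ends0 := alive_ends B (fun _ => false).
Hypothesis faD : map fa ends0 =i D.
Hypothesis words_fa : forall x, x \in ends0 -> words_at B x = map code (fwords (fa x)).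

Definition covers (dd : nat -> bool) := forall f, the_repair f -> f \in map fa (alive_ends B dd).

Lemma alive_sub dd : {subset alive_ends B dd <= ends0}.
Proof. by move=> x; rewrite !mem_alive => /and3P[-> ->]. Qed.

Lemma sumn_notin l : (sumn l).+1 \notin l.
Proof.
suff h : forall x, x \in l -> x <= sumn l by apply/negP => /h; rewrite ltnn.
move=> x; elim: l => //= y l IH; rewrite inE => /orP[/eqP ->|/IH]; lia.
Qed.

Definition repairF : form := anyF (map violF Sigma).

(** The fresh value depends on the remaining facts and can change from round to round; the program
    never contains it, only the symbol [KFresh]. *)
Lemma exists_fresh (C : seq nat) dd : exists N, [/\ N \notin C,
  forall d, (forall A, Forall_seq A Sigma -> A d) -> N \notin dep_csts d &
  forall x, x \in alive_ends B dd -> N \notin fwords (fa x)].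
Proof.
set l := C ++ flatten (map dep_csts Sigma) ++ flatten [seq fwords (fa x) | x <- alive_ends B dd].
exists (sumn l).+1; have := sumn_notin l; rewrite {2}/l !mem_cat !negb_or.
case/and3P=> h1 h2 h3; split=> //.
  by move=> d hd; apply: contra h2; apply: (hd _ (Forall_seq_flatten dep_csts Sigma)).
move=> x hx; apply: contra h3 => h; apply/flattenP; exists (fwords (fa x)) => //.
by apply/mapP; exists x.
Qed.

(** The violating fact is outside the repair, so losing it is harmless. Only the copy at [x] is
    deleted; duplicates elsewhere are left to later rounds. *)
Lemma covers_kill dd x : covers dd -> x \in alive_ends B dd ->
  sat (alive_ends B dd) (words_at B) [:: x] repairF ->
  covers (fun p => dd p || (x == p)).
Proof.
move=> hcov hx; rewrite sat_anyF has_map => /has_witness [d /= hs hd].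
have [N [_ /(_ d hd) hN1 hN2]] := exists_fresh [::] dd.
have [wfd _] := hd _ wfS.
have hw y : y \in alive_ends B dd -> words_at B y = map code (fwords (fa y)).
  by move=> /alive_sub; apply: words_fa.
have [nu h1 h2] := violF_sound hw hN2 wfd hN1 hx hs.
have nx : ~ the_repair (fa x).
  move=> hr; apply: h2; apply: (sat_UCQ_mono hcov).
  apply: (hd _ the_repair_consistent); apply: holds_conj_ext h1 => // f -> //.
move=> f hf; have /mapP[y hy e] := hcov f hf; rewrite e; apply: map_f.
move: hy; rewrite !mem_alive => /and3P[-> -> /negbTE ->] /=.
by apply/eqP => xy; apply: nx; rewrite xy -e.
Qed.

Lemma covers_stop dd : covers dd ->
  ~~ has (fun x => sat (alive_ends B dd) (words_at B) [:: x] repairF) (alive_ends B dd) ->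
  forall f, the_repair f <-> f \in map fa (alive_ends B dd).
Proof.
move=> hcov /hasPn hn f; split; first exact: hcov.
move=> hf; exists (fun g => g \in map fa (alive_ends B dd)); split=> //.
  by move=> g /mapP[x /alive_sub hx ->]; rewrite -faD; apply: map_f.
apply: Forall_seq_intro => d hd; have [wfd lind] := hd _ wfS.
have [N [_ /(_ d hd) hN1 hN2]] := exists_fresh [::] dd.
have hw y : y \in alive_ends B dd -> words_at B y = map code (fwords (fa y)).
  by move=> /alive_sub; apply: words_fa.
apply: (violF_complete hw hN2 wfd lind hN1) => x xE.
apply: contra (hn x xE) => hs; rewrite sat_anyF has_map.
have : Forall_seq (fun d => sat (alive_ends B dd) (words_at B) [:: x] (violF d) ->
  has (preim violF (sat (alive_ends B dd) (words_at B) [:: x])) Sigma) Sigma.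
  elim: (Sigma) => //= d' S IH; split; first by move=> ->.
  by apply: Forall_seq_impl IH => y h /h ->; rewrite orbT.
by move=> /hd; apply.
Qed.

Lemma size_alive_kill dd x : x \in alive_ends B dd ->
  size (alive_ends B (fun p => dd p || (x == p))) < size (alive_ends B dd).
Proof.
move=> hx.
have -> : alive_ends B (fun p => dd p || (x == p)) = [seq y <- alive_ends B dd | y != x].
  rewrite -filter_predI; apply: eq_filter => p /=.
  by rewrite negb_or [x == p]eq_sym andbA andbC.
rewrite size_filter -(count_predC (fun y => y != x)) -[X in X < _]addn0 ltn_add2l.
by rewrite -has_count; apply/hasP; exists x => //=; rewrite negbK.
Qed.

Variable K : nat.

Definition repairM : sweeper (tsym K) unit :=
  loopM (bindM (findM 0 (compileM K 1 repairF)) (fun b =>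
    if b then bindM (killM (peb K 0)) (fun _ => retM _ None) else retM _ (Some tt))).

(** The last 2 pays for the sweep that deletes the fact and the one that ends the round. *)
Definition find_cost (n : nat) := 2 + n * (fcost repairF n + 2) + 2.

(** Every round except the last deletes a live end sign, so there are at most [(size B).+1]
    rounds. *)
Lemma exec_repairM dd M : fdepth repairF <= K -> covers dd -> exists M' dd',
  exec repairM (tape B M dd) ((size B).+1 * find_cost (size B)) tt (tape B M' dd') /\
  forall f, the_repair f <-> f \in map fa (alive_ends B dd').
Proof.
move=> hK hcov.
suff H m : forall dd M, size (alive_ends B dd) < m -> covers dd -> exists M' dd',
    exec repairM (tape B M dd) (m * find_cost (size B)) tt (tape B M' dd') /\
    forall f, the_repair f <-> f \in map fa (alive_ends B dd').
  apply: H hcov; rewrite ltnS size_filter.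
  by apply: leq_trans (count_size _ _) _; rewrite size_iota.
elim: m => // m IH {hcov}dd {}M hm hcov.
set F := fun x => sat (alive_ends B dd) (words_at B) [:: x] repairF.
have [//| |//|M1 [_ e1 h1]] := @exec_findM K B dd 0 [::] (compileM K 1 repairF) F
   (fcost repairF (size B)) _ _ M.
  move=> M' x xE _ hM'; apply: test_compileM => //; first by rewrite /= xE.
  by case=> // _; rewrite hM'.
case: (boolP (has F _)) e1 h1 => hF e1 h1; last first.
  exists M1, dd; split; last exact: covers_stop.
  apply: exec_loop_stop; rewrite mulSn -addnA; apply: (exec_bindM e1).
  by apply: exec_leq (exec_retM _ _); lia.
have /andP[h2 h3] := h1 isT.
have hs := size_alive_kill h2.
have [|M2 [dd2 [e2 h4]]] := IH _ M1 _ (covers_kill hcov h2 h3).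
  by apply: leq_trans hs _.
exists M2, dd2; split=> //; rewrite mulSn; apply: exec_loop_more e2.
apply: (exec_bindM e1); rewrite -[2]/(1 + 1); apply: exec_bindM (exec_killM _ _ _ _) _.
exact: exec_retM.
Qed.
End Elimination.
End Repair.

(** * Reading the encoded database *)

Definition sym_of (s : isym) : sym :=
  match s with S0 => Some (Some false) | S1 => Some (Some true) | SSep => Some None | SEnd => None end.

Definition bit_syms (s : seq bool) : seq sym := map (fun b => Some (Some b)) s.

Fixpoint word_syms (ws : seq nat) : seq sym :=
  if ws is x :: ws' then
    bit_syms (code x) ++ (if ws' is [::] then [::] else Some None :: word_syms ws')
  else [::].

Lemma rev_enc_nat n : map sym_of (rev (enc_nat n)) = bit_syms (code n).
Proof.
by rewrite /enc_nat /bit_syms /code !map_rev -map_comp; congr rev; apply: eq_map => -[].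
Qed.

Lemma rev_enc_fact f : map sym_of (rev (enc_fact f)) = None :: word_syms (fwords f).
Proof.
case: f => p cs; rewrite /enc_fact catA rev_cat /=; congr (_ :: _).
elim/last_ind: cs => [|cs c IH] /=; first by rewrite cats0 rev_enc_nat cats0.
rewrite map_rcons flatten_rcons catA rev_cat rev_cons cat_rcons map_cat rev_enc_nat.
rewrite /= IH /fwords /= -rcons_cons rev_rcons /=; congr (_ ++ _).
by rewrite rev_cons; case: (rev cs).
Qed.

Lemma rev_enc_db D : map sym_of (rev (enc_db D)) =
  flatten [seq None :: word_syms (fwords f) | f <- rev D].
Proof.
rewrite /enc_db rev_flatten -map_comp -map_rev map_flatten -map_comp; congr flatten.
by apply: eq_map => f /=; rewrite rev_enc_fact.
Qed.

(** Lists the facts by recursion on the tape instead of by position, which suits induction over the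
    database. *)
Fixpoint end_words (s : seq sym) : seq (seq (seq bool)) :=
  match s with
  | [::] => [::]
  | None :: s' => fact_words s' :: end_words s'
  | _ :: s' => end_words s'
  end.

Lemma words_ends B : map (words_at B) (alive_ends B (fun _ => false)) = end_words B.
Proof.
elim: B => //= a s <-.
rewrite /alive_ends /= -[1]addn0 iotaDl filter_map.
have -> : [seq words_at s i | i <- iota 0 (size s) & (nth None s i == None) && ~~ false] =
  map (words_at (a :: s)) (map (addn 1)
    [seq i <- iota 0 (size s) | (nth None s i == None) && ~~ false]).
  by rewrite -map_comp.
by case: a => [a|] //=; rewrite /words_at /= drop0.
Qed.

Lemma fact_words_bits b s : fact_words (bit_syms b ++ s) =
  (b ++ head [::] (fact_words s)) :: behead (fact_words s).
Proof. by elim: b => [|x b IH] /=; [rewrite fact_words_head | rewrite IH]. Qed.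

(** The condition on [s] says that it is empty or begins with an end sign. *)
Lemma fact_words_syms ws s : ws <> [::] -> fact_words s = [:: [::]] ->
  fact_words (word_syms ws ++ s) = map code ws.
Proof.
move=> + hs; elim: ws => //= x [|y ws] IH _.
  by rewrite cats0 fact_words_bits hs /= cats0.
rewrite -catA fact_words_bits.
have -> : fact_words ((Some None :: word_syms (y :: ws)) ++ s) =
  [::] :: fact_words (word_syms (y :: ws) ++ s) by [].
by rewrite IH //= cats0.
Qed.

Lemma end_words_syms ws s : end_words (word_syms ws ++ s) = end_words s.
Proof.
elim: ws => //= x ws IH; rewrite -catA.
by elim: (code x) => //; case: ws IH.
Qed.

Lemma end_words_db (D : seq fact) :
  end_words (flatten [seq None :: word_syms (fwords f) | f <- D]) =
  [seq map code (fwords f) | f <- D].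
Proof.
elim: D => //= f D IH; rewrite end_words_syms IH fact_words_syms //; last by case: D {IH}.
by rewrite /fwords rev_cons; case: (rev _).
Qed.

Definition fact_at (B : seq sym) (p : nat) : fact :=
  let r := rev (map decode (words_at B p)) in (head 0 r, behead r).

Lemma fact_at_db D : let B := map sym_of (rev (enc_db D)) in
  let ends := alive_ends B (fun _ => false) in
  map (fact_at B) ends =i D /\
  forall x, x \in ends -> words_at B x = map code (fwords (fact_at B x)).
Proof.
move=> B ends.
have hw : map (words_at B) ends = [seq map code (fwords f) | f <- rev D].
  by rewrite words_ends /B rev_enc_db end_words_db.
have dec f : (let r := rev (map decode (map code (fwords f))) in (head 0 r, behead r)) = f.
  by rewrite (mapK codeK) /fwords revK; case: f.
split.
  move=> f; have -> : map (fact_at B) ends = rev D; last exact: mem_rev.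
  pose g (ws : seq (seq bool)) : fact := let r := rev (map decode ws) in (head 0 r, behead r).
  rewrite -[LHS]/(map (g \o words_at B) ends) map_comp hw -map_comp -[RHS]map_id.
  by apply: eq_map => f'; apply: dec.
move=> x hx; have : words_at B x \in map (words_at B) ends by apply: map_f.
by rewrite hw => /mapP[f _ e]; have := dec f; rewrite /= /fact_at e => ->.
Qed.

Definition inp (K : nat) (s : isym) : tsym K := (sym_of s, false, [ffun => false]).

Lemma input_tape K w : let B := map sym_of (rev w) in
  rev (map (inp K) w) = tape B (fun _ => size B) (fun _ => false).
Proof.
move=> B; rewrite -map_rev; apply: (@eq_from_nth _ (inp K S0)).
  by rewrite size_map size_mkseq size_map.
move=> i; rewrite size_map => hi; rewrite nth_mkseq ?size_map // (nth_map S0) //.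
rewrite (nth_map S0) //; congr (_, _); apply/ffunP => m; rewrite !ffunE.
by rewrite gtn_eqF // /B size_map.
Qed.

(** * The machine for fixed dependencies and a fixed query *)

Theorem theorem12 (ar : nat -> nat) (Sigma : seq dep) (Q : UCQ) :
  Forall_seq (fun d => dep_wf ar d /\ linear_dep d) Sigma ->
  safe_BUCQ ar Q ->
  exists (M : TM) (k : nat),
    tm_acc M <> tm_rej M /\
    forall D : seq fact, db_wf ar D ->
      decides_within M (enc_db D) (k * (size (enc_db D)).+1 ^ k)
        (IAR_entails Sigma D Q).
Proof.
move=> wfS safeQ.
(* The query has no free variables, so the kind assigned to them is an arbitrary default. *)
pose rF := repairF Sigma; pose qF := ucqF (fun _ => KFresh) 0 Q.
pose K := fdepth rF + fdepth qF.
pose main := bindM (repairM Sigma K) (fun _ => compileM K 0 qF).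
pose rounds n := n.+1 * find_cost Sigma n + fcost qF n.
have [k hk] : poly_bounded (fun n => n.+1 + rounds n * (2 * n + 2)).
  rewrite /rounds /find_cost.
  have pS : poly_bounded succn.
    by have [k h] := poly_add (poly_cst 1) poly_id; exists k => n; rewrite -add1n.
  do ?[exact: pS | exact: poly_fcost | exact: poly_id | exact: poly_cst
      | apply: poly_add | apply: poly_mul].
exists (sweeper_TM (inp K) main), k; split=> // D _.
set w := enc_db D; pose B := map sym_of (rev w).
have sB : size B = size w by rewrite size_map size_rev.
have [faD wfa] := fact_at_db D; rewrite -/w -/B in faD wfa.
have cov : covers Sigma D B (fact_at B) (fun _ => false).
  by move=> f [R [h _ /h]]; rewrite faD.
have hK : fdepth (repairF Sigma) <= K by apply: leq_addr.
have [M' [dd' [e1 h1]]] := exec_repairM wfS faD wfa (fun _ => size B) hK cov.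
have [M2 _ e2] : test 0 (compileM K 0 qF) B M' dd' (fcost qF (size B))
    (sat (alive_ends B dd') (words_at B) [::] qF).
  by apply: test_compileM => //; rewrite add0n /K; lia.
apply: sweeper_TM_decides (hk (size w)).
  by rewrite input_tape /rounds -sB; apply: exec_bindM e1 e2.
rewrite (IAR_the_repair _ wfS).
(* For the query, the fresh value has to avoid the query's own inequality constants and the words of
   the repair. *)
have [N [hN1 _ hN2]] := exists_fresh Sigma B (fact_at B)
  (flatten [seq neq_csts (cq_body q) | q <- Q]) dd'.
have hw y : y \in alive_ends B dd' -> words_at B y = map code (fwords (fact_at B y)).
  by move=> /alive_sub; apply: wfa.
have -> : sat_UCQ (the_repair Sigma D) (fun _ => 0) Q <->
    sat_UCQ (fun f => f \in map (fact_at B) (alive_ends B dd')) (fun _ => 0) Q.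
  by split; apply: sat_UCQ_mono => f /h1.
apply: (@ucqF_correct _ _ (fact_at B) N hw hN2 [::]) => //.
have := Forall_seq_and safeQ (Forall_seq_flatten (fun q => neq_csts (cq_body q)) Q).
apply: Forall_seq_impl => q [[_ [hf hs]] hc]; split.
- by apply: contra hN1 => /hc.
- by move=> v hv _; apply: hs.
- move=> v hv hx; have : v \in cq_free_vars q by rewrite mem_filter hx.
  by rewrite hf.
Qed.
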